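(* Let $n \geq 3$ be an integer and define $Q_n : \mathbb{R}_{\geq 0} \rightarrow \mathbb{R}$ by $$ Q_n(t) = 2^{\frac{n-2}{2}}\, \Gamma(n/2)\, n\, \omega_n \int_0^t s^{\frac{4-n}{2}} J_{\frac{n-2}{2}}(s)\, ds.$$ Let $\lambda > 0$, $r > 0$, $x \in \mathbb{R}^n$, and suppose that $\phi$ is a real-valued function satisfying $-\Delta \phi = \lambda \phi$ in a neighborhood of $B(x,r) \subset \mathbb{R}^n$. Then $$ \int_{\|x-y\| \leq r} \frac{\phi(y)}{\|y-x\|^{n-2}}\, dy = \frac{1}{\lambda}\, Q_n(\sqrt{\lambda}\cdot r) \cdot \phi(x).$$ In particular, when $n=3$, $$ \int_{\|x-y\| \leq r} \frac{\phi(y)}{\|y-x\|}\, dy = 4\pi\, \frac{1 - \cos(\sqrt{\lambda}\cdot r)}{\lambda} \cdot \phi(x).$$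
   Context: $B(x,r) = \{y \in \mathbb{R}^n : \|x-y\| \leq r\}$ is the Euclidean ball, $\Delta$ is the Laplacian on $\mathbb{R}^n$, $\omega_n$ denotes the volume of the unit ball in $\mathbb{R}^n$, $\Gamma$ is the Gamma function, and $J_\nu$ is the Bessel function of the first kind of order $\nu$. The solution $\phi$ is understood in the classical sense (twice continuously differentiable, hence smooth). *)

(* Defs.v *)
From HB Require Import structures.
From mathcomp Require Import all_boot all_order all_algebra.
From mathcomp Require Import all_classical all_reals all_analysis.

Set Implicit Arguments.
Unset Strict Implicit.
Unset Printing Implicit Defensive.

Import Order.TTheory GRing.Theory Num.Theory.
Import numFieldNormedType.Exports.

Local Open Scope classical_set_scope.
Local Open Scope ring_scope.

Definition measure_rV_display : measure_display -> measure_display.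
Proof. exact. Qed.

(* 'rV[T]_n carries the product sigma-algebra, generated by the coordinates. *)
Section measurable_rV.
Context {d} {T : sigmaRingType d} (n : nat).

Let coords : 'I_n -> 'rV[T]_n -> T := fun i v => v ord0 i.

Let rV_set0 : g_sigma_preimage coords set0.
Proof. exact: sigma_algebra0. Qed.

Let rV_setC A : g_sigma_preimage coords A -> g_sigma_preimage coords (~` A).
Proof. exact: sigma_algebraC. Qed.

Let rV_bigcup (F : (set 'rV[T]_n)^nat) :
  (forall i, g_sigma_preimage coords (F i)) ->
  g_sigma_preimage coords (\bigcup_i (F i)).
Proof. exact: sigma_algebra_bigcup. Qed.

HB.instance Definition _ := @isMeasurable.Build (measure_rV_display d)
  'rV[T]_n (g_sigma_preimage coords) rV_set0 rV_setC rV_bigcup.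

End measurable_rV.

Lemma measurable_coord d (T : sigmaRingType d) n (i : 'I_n) :
  measurable_fun [set: 'rV[T]_n] (fun v : 'rV[T]_n => v ord0 i).
Proof.
move=> _ Y mY; rewrite setTI; apply: sub_sigma_algebra => /=.
rewrite -bigcup_seq/=; exists i => /=; first by rewrite mem_index_enum.
by exists Y => //; rewrite setTI.
Qed.

Lemma measurable_fun_rVP d1 d2 (T1 : measurableType d1) (T2 : measurableType d2)
    n (f : T1 -> 'rV[T2]_n) :
  (forall i, measurable_fun [set: T1] (fun t => f t ord0 i)) ->
  measurable_fun [set: T1] f.
Proof.
move=> mf _ A mA; rewrite setTI.
suff: g_sigma_preimage (fun i (t : T1) => f t ord0 i) `<=` measurable.
  apply; rewrite (g_sigma_preimage_comp (fun i (v : 'rV[T2]_n) => v ord0 i) f).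
  by exists A => //; rewrite setTI.
apply: smallest_sub; first exact: sigma_algebra_measurable.
rewrite -bigcup_seq/=; apply: bigcup_sub => i _.
by move=> _ [B mB <-]; exact: mf.
Qed.

Section lebesgue_rV.
Context {R : realType}.

Definition rV_cons n (p : R * 'rV[R]_n) : 'rV[R]_n.+1 :=
  row_mx p.1%:M p.2.

Lemma rV_cons0 n p : @rV_cons n p ord0 ord0 = p.1.
Proof.
rewrite (_ : ord0 = lshift n (ord0 : 'I_1)); last exact/val_inj.
by rewrite [LHS]row_mxEl mxE.
Qed.

Lemma rV_consS n p i : @rV_cons n p ord0 (lift ord0 i) = p.2 ord0 i.
Proof.
rewrite (_ : lift ord0 i = rshift 1 i); last exact/val_inj.
by rewrite [LHS]row_mxEr.
Qed.

Lemma measurable_rV_cons n : measurable_fun setT (@rV_cons n).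
Proof.
apply: measurable_fun_rVP => i; have [j ->|->] := unliftP ord0 i.
  rewrite (_ : (fun _ => _) = (fun v : 'rV[R]_n => v ord0 j) \o snd).
    by apply: measurableT_comp => //; exact: measurable_coord.
  by apply/funext => p; rewrite rV_consS.
rewrite (_ : (fun _ => _) = fst)//.
by apply/funext => p; rewrite rV_cons0.
Qed.

Definition rV_uncons n (v : 'rV[R]_n.+1) : R * 'rV[R]_n :=
  (v ord0 ord0, @rsubmx _ 1 1 n v).

Lemma rV_consK n : cancel (@rV_cons n) (@rV_uncons n).
Proof.
by case=> a v; congr pair; [exact: rV_cons0|exact: row_mxKr].
Qed.

Lemma measurable_rV_uncons n : measurable_fun setT (@rV_uncons n).
Proof.
apply: measurable_fun_pair; first exact: measurable_coord.
apply: measurable_fun_rVP => i.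
rewrite (_ : (fun _ => _) =
  fun v : 'rV[R]_n.+1 => v ord0 (rshift 1 i : 'I_n.+1)).
  exact: measurable_coord.
by apply/funext => v; rewrite mxE.
Qed.

Section lebesgue_rV_cons.
Context n (mu : {sigma_finite_measure set 'rV[R]_n -> \bar R}).

Definition lebesgue_rV_cons : set 'rV[R]_n.+1 -> \bar R :=
  pushforward (@lebesgue_measure R \x mu)%E (@rV_cons n).

Let mcons := @measurable_rV_cons n.

Let cons0 : lebesgue_rV_cons set0 = 0%E.
Proof. exact: measure0. Qed.

Let cons_ge0 A : (0 <= lebesgue_rV_cons A)%E.
Proof. exact: measure_ge0. Qed.

Let cons_sigma_additive : semi_sigma_additive lebesgue_rV_cons.
Proof. exact: measure_semi_sigma_additive. Qed.

HB.instance Definition _ := isMeasure.Build _ _ _ lebesgue_rV_cons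
  cons0 cons_ge0 cons_sigma_additive.

Let cons_sigma_finite : sigma_finite setT lebesgue_rV_cons.
Proof.
have /sigma_finiteP[F [TF ndF Foo]] := sigma_finiteT (@lebesgue_measure R).
have /sigma_finiteP[G [TG ndG Goo]] := sigma_finiteT mu.
exists (fun k => @rV_uncons n @^-1` (F k `*` G k)).
  rewrite -preimage_bigcup (_ : \bigcup_k _ = setT) ?preimage_setT//.
  rewrite -setXTT TF TG predeqE => -[x y]; split.
    by move=> [k _ []/= ? ?]; split; exists k.
  move=> [/= [k _ Fkx] [l _ Gly]]; exists (maxn k l) => //; split.
  - by move: x Fkx; exact/subsetPset/ndF/leq_maxl.
  - by move: y Gly; exact/subsetPset/ndG/leq_maxr.
move=> k; have [mF Fk] := Foo k; have [mG Gk] := Goo k.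
split.
  rewrite -[X in measurable X]setTI; apply: measurable_rV_uncons => //.
  exact: measurableX.
rewrite /lebesgue_rV_cons /pushforward -comp_preimage.
rewrite (_ : @rV_uncons n \o @rV_cons n = id); last first.
  by apply/funext => p /=; rewrite rV_consK.
by rewrite preimage_id product_measure1E// lte_mul_pinfty// ge0_fin_numE.
Qed.

HB.instance Definition _ := Measure_isSigmaFinite.Build _ _ _ lebesgue_rV_cons
  cons_sigma_finite.

End lebesgue_rV_cons.

Fixpoint lebesgue_rV n : {sigma_finite_measure set 'rV[R]_n -> \bar R} :=
  if n is n'.+1 then lebesgue_rV_cons (lebesgue_rV n')
  else \d_ (0 : 'rV[R]_0).

Lemma lebesgue_rV_box n (A : 'I_n -> set (measurableTypeR R)) :
  (forall i, measurable (A i)) ->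
  lebesgue_rV n [set v : 'rV[R]_n | forall i, A i (v ord0 i)] =
  (\prod_(i < n) lebesgue_measure (A i))%E.
Proof.
elim: n A => [|n IHn] A mA.
  by rewrite big_ord0 /= diracE mem_set// => -[].
rewrite big_ord_recl /= -(IHn (fun i => A (lift ord0 i)))//.
rewrite /lebesgue_rV_cons /pushforward -product_measure1E//; last first.
  set B := (X in measurable X); rewrite (_ : B =
      \bigcap_(i in [set: 'I_n]) (fun v : 'rV[R]_n => v ord0 i) @^-1`
        A (lift ord0 i)); last first.
    by apply/seteqP; split => [v Bv i _|v Bv i]; exact: Bv.
  apply: fin_bigcap_measurable => // i _.
  rewrite -[X in measurable X]setTI.
  by apply: measurable_coord => //; exact: mA.
congr (_ _); apply/seteqP; split => -[a v] /=.
  move=> h; split => [|i]; first by have := h ord0; rewrite rV_cons0.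
  by have := h (lift ord0 i); rewrite rV_consS.
move=> [Aa Av] i; have [j ->|->] := unliftP ord0 i; last by rewrite rV_cons0.
by rewrite rV_consS.
Qed.

End lebesgue_rV.

Section euclidean.
Context {R : realType} {n : nat}.
Implicit Types (x y v : 'rV[R]_n) (U : set 'rV[R]_n) (f : 'rV[R]_n -> R).

(* The library norm on 'rV[R]_n is the sup norm. *)
Definition enorm v : R := Num.sqrt (\sum_(i < n) v ord0 i ^+ 2).

Definition eball x (r : R) : set 'rV[R]_n := [set y | enorm (x - y) <= r].

Definition partial (i : 'I_n) f : 'rV[R]_n -> R :=
  'D_(delta_mx ord0 i : 'rV[R]_n) f.

Definition has_partial (i : 'I_n) f y : Prop :=
  derivable f y (delta_mx ord0 i : 'rV[R]_n).

Definition laplacian f y : R := \sum_(i < n) partial i (partial i f) y.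

(* f is of class C^2 on U, to be used with U open: all partial derivatives of
   order at most 2 exist and are continuous at every point of U. *)
Definition C2_on U f : Prop :=
  forall y, U y ->
    [/\ {for y, continuous f},
        forall i, has_partial i f y /\ {for y, continuous (partial i f)} &
        forall i j, has_partial j (partial i f) y /\
                    {for y, continuous (partial j (partial i f))}].

End euclidean.

Section special_functions.
Context {R : realType}.
Implicit Types x nu s t : R.

(* Euler's integral, meaningful for x > 0. *)
Definition Gamma x : R :=
  \int[@lebesgue_measure R]_(t in `]0, +oo[%classic)
    (t `^ (x - 1) * expR (- t)).

(* Bessel function of the first kind of real order nu, for nu, s >= 0:
   J_nu(s) = \sum_k (-1)^k / (k! Gamma(k + nu + 1)) (s / 2)^(2 k + nu). *)
Definition besselJ nu s : R :=
  limn (series (fun k : nat =>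
    (-1) ^+ k / (k`!%:R * Gamma (k%:R + nu + 1))
      * (s / 2) `^ (2 * k%:R + nu))).

Definition omega (n : nat) : R :=
  fine (lebesgue_rV n (eball (0 : 'rV[R]_n) 1)).

Definition Q (n : nat) t : R :=
  2 `^ ((n%:R - 2) / 2) * Gamma (n%:R / 2) * n%:R * omega n *
  \int[@lebesgue_measure R]_(s in `[0, t]%classic)
    (s `^ ((4 - n%:R) / 2) * besselJ ((n%:R - 2) / 2) s).

End special_functions.

(* Main.v *)
(* Put [G_m(rho) = \int_(|z| <= 1) phi(x + rho z) (1 - |z|^2)^m dz].  Integrating the
   radial derivative of [phi] and integrating by parts once (the weight
   [(1 - |z|^2)^(m+1)] vanishes on the sphere) gives
     [G_m(rho) = c_m phi(x) - lambda / (2 (m+1)) \int_0^rho t G_(m+1)(t) dt],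
   where [c_m = \int_(|z| <= 1) (1 - |z|^2)^m dz].  As the [G_m] are bounded uniformly in
   [m], iterating this identity expands [G_0(rho)] as [phi(x)] times an explicit even power
   series in [rho]; the case [phi = z_i] of the integration by parts gives the ratio
   [c_(m+1) / c_m], hence Gamma quotients.  Finally, since
   [s^(2-n) = r^(2-n) + (n-2) \int_s^r rho^(1-n) drho],
     [\int_(B(x,r)) phi(y) |y-x|^(2-n) dy = r^2 G_0(r) + (n-2) \int_0^r rho G_0(rho) drho],
   and termwise integration of the Bessel series yields the same power series for
   [Q_n(sqrt lambda r) phi(x) / lambda].  No surface measure is needed. *)
From HB Require Import structures.
Require Import Defs.
From mathcomp Require Import all_boot all_order all_algebra.
From mathcomp Require Import all_classical all_reals all_analysis.
From mathcomp Require Import measurable_realfun ring lra.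

Set Implicit Arguments.
Unset Strict Implicit.
Unset Printing Implicit Defensive.

Import Order.TTheory GRing.Theory Num.Theory.
Import numFieldNormedType.Exports.

Local Open Scope classical_set_scope.
Local Open Scope ring_scope.

(** * Lebesgue measure on row vectors *)

(** A line parallel to an axis meets the unit ball in a segment [[-b, b]] on which
    [1 - |z|^2 = b^2 - a^2]. Hence the boundary terms of the integration by parts vanish slice by
    slice, and Fubini does the rest. Since the measure is built by prepending one coordinate,
    slicing along an arbitrary coordinate rests on the uniqueness of a measure with prescribed
    values on boxes. Regularity is given through continuous partial derivatives only, so the
    derivative of [phi] along a segment has to be recovered from them. Each iteration contributes
    [lambda / (2 (m+1))] and one integration of an odd power; after [N] of them the remainder
    carries [m! / ((m+N)! N!)], which beats every power of [lambda rho^2 / 4], so the radius need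
    not be small. The bound [n >= 3] gives [n/2 > 1], the range in which the integrand of [Gamma] is
    continuous at 0 and the recurrence is derived. [Gamma] enters through quotients only:
    [Gamma (n/2)] occurs on both sides. For [n = 3] what remains is the volume of the unit ball,
    obtained by slicing up from dimension one. *)

Lemma pushforward_measure d1 d2 (T1 : measurableType d1) (T2 : measurableType d2)
    (R : realType) (m : {measure set T1 -> \bar R}) (f : T1 -> T2) :
  measurable_fun setT f ->
  exists nu : {measure set T2 -> \bar R}, forall A, nu A = m (f @^-1` A).
Proof.
move=> mf; pose nu := HB.pack_for {measure set T2 -> \bar R} (pushforward m f)
  (Measure.on (pushforward m f)).
by exists (nu mf).
Qed.

Section row_measure.
Context {R : realType}.

Definition rV_box n (A : 'I_n -> set (measurableTypeR R)) : set 'rV[R]_n :=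
  [set v | forall i, A i (v ord0 i)].

Lemma measurable_rV_box n (A : 'I_n -> set (measurableTypeR R)) :
  (forall i, measurable (A i)) -> measurable (rV_box A).
Proof.
move=> mA; rewrite (_ : rV_box A = \bigcap_(i in [set: 'I_n])
    ((fun v : 'rV[R]_n => v ord0 i) @^-1` A i)); last first.
  by apply/seteqP; split => [v Av i _|v Av i]; exact: Av.
apply: fin_bigcap_measurable => // i _.
rewrite -[X in measurable X]setTI.
by apply: measurable_coord => //; exact: mA.
Qed.

(** Boxes are stable under intersection, generate the product sigma-algebra, and the cubes
    [[-k, k]^n] exhaust the space with finite measure. Every invariance property of [lebesgue_rV]
    below is reduced to this criterion. *)
Lemma lebesgue_rV_unique n (m : {measure set 'rV[R]_n -> \bar R}) :
  (forall A : 'I_n -> set (measurableTypeR R), (forall i, measurable (A i)) ->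
     m (rV_box A) = (\prod_(i < n) lebesgue_measure (A i))%E) ->
  forall A, measurable A -> m A = lebesgue_rV n A.
Proof.
move=> mbox; pose G : set (set 'rV[R]_n) :=
  [set B | exists2 A : 'I_n -> set (measurableTypeR R),
     (forall i, measurable (A i)) & B = rV_box A].
pose g k : set 'rV[R]_n := rV_box (fun _ => `[- k%:R, k%:R]%classic).
apply: (measure_unique G g).
- apply/seteqP; split; last first.
    apply: smallest_sub; first exact: sigma_algebra_measurable.
    by move=> _ [A mA ->]; exact: measurable_rV_box.
  apply: smallest_sub; first exact: smallest_sigma_algebra.
  rewrite -bigcup_seq/=; apply: bigcup_sub => i _.
  move=> _ [B mB <-]; apply: sub_sigma_algebra.
  (* A cylinder over one coordinate is a box whose other sides are the whole line. *)
  exists (fun j => if j == i then B else setT) => [j|]; first by case: ifP.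
  apply/seteqP; split => v /=; first by move=> [_ Bv] j; case: eqP => // ->.
  by move=> /(_ i); rewrite eqxx.
- move=> _ _ [A mA ->] [B mB ->].
  exists (fun i => A i `&` B i) => [i|]; first exact: measurableI.
  apply/seteqP; split => v /=; first by move=> [Av Bv] i; split.
  by move=> ABv; split => i; have [] := ABv i.
- by move=> k; exists (fun _ => `[- k%:R, k%:R]%classic).
- apply/seteqP; split => // v _.
  (* This integer exceeds every [|v_i|], so [v] lies in the cube [g k]. *)
  pose k := (Num.trunc (\sum_i `|v ord0 i|)).+1.
  exists k => // i /=; rewrite in_itv/= -ler_norml.
  apply: (@le_trans _ _ (\sum_i `|v ord0 i|)).
    by rewrite (bigD1 i)//= lerDl sumr_ge0.
  by rewrite ltW// truncnS_gt.
- by move=> _ [A mA ->]; rewrite mbox//; exact/esym/lebesgue_rV_box.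
- move=> k; rewrite /g mbox//.
  rewrite (eq_bigr (fun _ => (k%:R - - k%:R)%:E)) => [|i _]; last first.
    rewrite /= lebesgue_measure_itv/= lte_fin; case: ifP => //.
    move=> /negbT; rewrite -leNgt => h; congr EFin.
    by have := ler0n R k; lra.
  by rewrite prodEFin ltry.
Qed.

(** [rV_cons] inserts in front only; insertion at position [i] allows Fubini along any chosen
    coordinate. *)
Definition rV_ins n (i : 'I_n.+1) (p : R * 'rV[R]_n) : 'rV[R]_n.+1 :=
  \row_j (if unlift i j is Some k then p.2 ord0 k else p.1).

Lemma rV_ins_id n (i : 'I_n.+1) p : rV_ins i p ord0 i = p.1.
Proof. by rewrite mxE unlift_none. Qed.

Lemma rV_ins_lift n (i : 'I_n.+1) p k : rV_ins i p ord0 (lift i k) = p.2 ord0 k.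
Proof. by rewrite mxE liftK. Qed.

Lemma measurable_rV_ins n (i : 'I_n.+1) : measurable_fun setT (rV_ins i).
Proof.
apply: measurable_fun_rVP => j; have [k ->|->] := unliftP i j.
  rewrite (_ : (fun _ => _) = (fun v : 'rV[R]_n => v ord0 k) \o snd).
    by apply: measurableT_comp => //; exact: measurable_coord.
  by apply/funext => p; rewrite rV_ins_lift.
rewrite (_ : (fun _ => _) = fst)//.
by apply/funext => p; rewrite rV_ins_id.
Qed.

(** The preimage of a box under the insertion is the side [A i] times the box of the remaining
    sides, so the pushforward has the right values on boxes. *)
Lemma lebesgue_rV_ins n (i : 'I_n.+1) A : measurable A ->
  pushforward (@lebesgue_measure R \x lebesgue_rV n)%E (rV_ins i) A =
  lebesgue_rV n.+1 A.
Proof.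
have [nu nuE] := pushforward_measure (@lebesgue_measure R \x lebesgue_rV n)%E
  (@measurable_rV_ins n i).
rewrite /pushforward -nuE; apply: lebesgue_rV_unique => {}A mA.
rewrite (bigD1_ord i)//= nuE.
rewrite (_ : _ @^-1` _ = A i `*` rV_box (fun k => A (lift i k))).
  rewrite [LHS]product_measure1E//; last exact: measurable_rV_box.
  by congr (_ * _)%E; exact: lebesgue_rV_box.
apply/seteqP; split => -[a v] /=.
  move=> h; split => [|k /=]; first by have := h i; rewrite rV_ins_id.
  by have := h (lift i k); rewrite rV_ins_lift.
move=> [Aa Av] j; have [k ->|->] := unliftP i j; last by rewrite rV_ins_id.
by rewrite rV_ins_lift; exact: Av.
Qed.

Lemma lebesgue_measure_affine (c k : R) (A : set (measurableTypeR R)) :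
  0 < k -> measurable A ->
  lebesgue_measure A =
  (k%:E * lebesgue_measure ((fun a : R => (c + k * a)%R) @^-1` A)%classic)%E.
Proof.
move=> k0 mA.
have mf : measurable_fun (setT : set (measurableTypeR R))
    (fun a : measurableTypeR R => c + k * a : measurableTypeR R).
  by apply: measurable_funD => //; apply: measurable_funM.
have [nu0 nuE] := pushforward_measure (@lebesgue_measure R) mf.
pose nu := mscale (NngNum (ltW k0)) nu0.
rewrite (@lebesgue_measure_unique _ nu _ A mA).
  by rewrite /nu/= /mscale/= nuE.
move=> _ [[a b] _ <-]; rewrite /nu/= /mscale/= nuE.
rewrite (_ : _ @^-1` _ = `](a - c) / k, (b - c) / k]%classic); last first.
  apply/seteqP; split => t /=; rewrite !in_itv/= ltr_pdivrMr// ler_pdivlMr//;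
  by rewrite ltrBlDl lerBrDl [t * k]mulrC.
rewrite lebesgue_measure_itv/= lebesgue_measure_itv/= !lte_fin ltr_pM2r ?invr_gt0// ltrD2r.
case: ifP => _; last by rewrite mule0.
by rewrite -!EFinB -EFinM; congr EFin; field; rewrite gt_eqF.
Qed.

Lemma measurable_rV_affine n (x : 'rV[R]_n) (k : R) :
  measurable_fun setT (fun z : 'rV[R]_n => x + k *: z).
Proof.
apply: measurable_fun_rVP => i.
rewrite (_ : (fun _ => _) = (fun a => x ord0 i + k * a) \o
    (fun v : 'rV[R]_n => v ord0 i)).
  apply: measurableT_comp; last exact: measurable_coord.
  by apply: measurable_funD => //; apply: measurable_funM.
by apply/funext => p /=; rewrite !mxE.
Qed.

(** The preimage of a box is the box of the preimages of its sides, and each of the [n] sides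
    contributes one factor [k] by the one-dimensional case. *)
Lemma lebesgue_rV_affine n (x : 'rV[R]_n) (k : R) A : 0 < k -> measurable A ->
  lebesgue_rV n A =
  ((k ^+ n)%:E * lebesgue_rV n ((fun z : 'rV[R]_n => (x + k *: z)%R) @^-1` A)%classic)%E.
Proof.
move=> k0 mA.
have [nu0 nuE] := pushforward_measure (lebesgue_rV n) (measurable_rV_affine x k).
have k0' : 0 <= k ^+ n by rewrite exprn_ge0// ltW.
pose nu := mscale (NngNum k0') nu0.
rewrite -(@lebesgue_rV_unique _ nu _ A mA); first by rewrite /nu/= /mscale/= nuE.
move=> {mA}A mA; rewrite /nu/= /mscale/= nuE.
rewrite (_ : _ @^-1` _ =
    rV_box (fun i => (fun a => x ord0 i + k * a) @^-1` A i)); last first.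
  by apply/seteqP; split => v /= h i; have := h i; rewrite !mxE.
transitivity ((k ^+ n)%:E * \prod_(i < n)
    lebesgue_measure ((fun a : R => (x ord0 i + k * a)%R) @^-1` A i)%classic)%E.
  congr (_ * _)%E; apply: lebesgue_rV_box => i.
  rewrite -[X in measurable X]setTI.
  have mf : measurable_fun setT (fun a : R => x ord0 i + k * a).
    by apply: measurable_funD => //; apply: measurable_funM.
  by apply: mf => //; exact: mA.
rewrite [RHS](eq_bigr _ (fun i _ => lebesgue_measure_affine (x ord0 i) k0 (mA i))).
by rewrite big_split/= prodEFin prodr_const card_ord.
Qed.

End row_measure.

(** * Open sets, Euclidean balls and measurability of row vectors *)

Section row_measurable.
Context {R : realType}.

(** The sigma-algebra is generated by the coordinates, not by the topology. The two meet because an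
    open set is the countable union of the cubes with rational centre and side [2 / (k+1)] that it
    contains. *)
Lemma measurable_open_rV n (A : set 'rV[R]_n) : open A -> measurable A.
Proof.
move=> oA.
pose B (p : 'rV[rat]_n * nat) : set 'rV[R]_n :=
  rV_box (fun i => ball (ratr (p.1 ord0 i) : R) (p.2.+1%:R^-1)).
have -> : A = \bigcup_p (if `[< B p `<=` A >] then B p else set0).
  apply/seteqP; split => [y Ay|y [p _]]; last first.
    by case: asboolP => // + By; exact.
  have /nbhs_ballP[e /= e0 yeA] : nbhs y A by exact: open_nbhs_nbhs.
  (* A centre within [1/(k+1)] of [y] and a cube of radius [1/(k+1)] around it stay within
     [2/(k+1) < e] of [y] in the sup norm. *)
  pose k := Num.trunc (2 / e).
  have ke : k.+1%:R^-1 * 2 < e.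
    by rewrite mulrC ltr_pdivrMr// -ltr_pdivrMl// mulrC truncnS_gt.
  have /choice[q qP] : forall i : 'I_n, exists q : rat,
      `|y ord0 i - ratr q| < k.+1%:R^-1.
    move=> i; have [|q] := @rat_in_itvoo R (y ord0 i) (y ord0 i + k.+1%:R^-1).
      by rewrite ltrDl invr_gt0.
    rewrite in_itv/= => /andP[yq qy]; exists q.
    by rewrite distrC gtr0_norm ?subr_gt0// ltrBlDl.
  exists (\row_i q i, k) => //.
  have -> : `[< B (\row_i q i, k) `<=` A >].
    apply/asboolP => z Bz; apply: yeA; split => // j i.
    rewrite (ord1 j) -ball_normE/=.
    have := Bz i; rewrite -ball_normE/= mxE => qz.
    have yq := qP i.
    apply: le_lt_trans (ler_distD (ratr (q i)) _ _) _.
    by apply: lt_trans ke; rewrite mulr_natr mulr2n ltrD.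
  by move=> i; rewrite -ball_normE/= mxE distrC.
apply: countable_bigcupT_measurable; first exact: countableP.
move=> p; case: ifP => // _; apply: measurable_rV_box => i.
exact: measurable_ball.
Qed.

Lemma continuous_measurable_rV n (U D : set 'rV[R]_n) (f : 'rV[R]_n -> R) :
  open U -> measurable D -> D `<=` U -> (forall y, U y -> {for y, continuous f}) ->
  measurable_fun D f.
Proof.
move=> oU mD DU cf; apply: (@measurable_funS _ _ _ _ U) => //.
  exact: measurable_open_rV.
apply: (measurability _ (RGenOpens.measurableE R)).
move=> _ [_ [a [b ->] <-]]; apply: measurable_open_rV.
rewrite openE => y [Uy aby].
apply: filterI; first exact: open_nbhs_nbhs.
by apply: (cf y Uy); apply: open_nbhs_nbhs; split => //; exact: interval_open.
Qed.

(** The square of [enorm], kept free of the root so that the weights [1 - sqn z] are polynomial in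
    the coordinates. *)
Definition sqn n (v : 'rV[R]_n) : R := \sum_(i < n) v ord0 i ^+ 2.

Lemma sqn_ge0 n (v : 'rV[R]_n) : 0 <= sqn v.
Proof. by apply: sumr_ge0 => i _; exact: sqr_ge0. Qed.

Lemma sqnZ n (k : R) (v : 'rV[R]_n) : sqn (k *: v) = k ^+ 2 * sqn v.
Proof.
by rewrite /sqn mulr_sumr; apply: eq_bigr => i _; rewrite mxE exprMn.
Qed.

Lemma eballE n (x : 'rV[R]_n) (r : R) y : 0 <= r ->
  eball x r y <-> sqn (x - y) <= r ^+ 2.
Proof.
move=> r0; rewrite /eball /enorm /=.
rewrite -{1}(ger0_norm r0) -sqrtr_sqr.
by rewrite ler_sqrt ?exprn_ge0.
Qed.

Lemma eball01E n (z : 'rV[R]_n) : eball 0 1 z <-> sqn z <= 1.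
Proof.
rewrite eballE// expr1n sub0r -scaleN1r sqnZ sqrrN expr1n mul1r//.
Qed.

Lemma enormE n (v : 'rV[R]_n) : enorm v = Num.sqrt (sqn v).
Proof. by []. Qed.

Lemma enormZ n (k : R) (v : 'rV[R]_n) : enorm (k *: v) = `|k| * enorm v.
Proof. by rewrite !enormE sqnZ sqrtrM ?sqr_ge0// sqrtr_sqr. Qed.

Lemma enormN n (v : 'rV[R]_n) : enorm (- v) = enorm v.
Proof. by rewrite -scaleN1r enormZ normrN1 mul1r. Qed.

Lemma measurable_sqn n : measurable_fun setT (@sqn n).
Proof.
apply: measurable_sum => i; apply: measurable_funX; exact: measurable_coord.
Qed.

Lemma measurable_enorm n : measurable_fun setT (@enorm R n).
Proof.
apply: measurableT_comp; last exact: measurable_sqn.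
by apply: continuous_measurable_fun; exact: sqrt_continuous.
Qed.

Lemma measurable_eball n (x : 'rV[R]_n) (r : R) : measurable (eball x r).
Proof.
have -> : eball x r = ((@enorm R n) \o (fun y => x + (-1) *: y)) @^-1` `]-oo, r]%classic.
  by apply/seteqP; split => y; rewrite /eball/= in_itv/= scaleN1r.
rewrite -[X in measurable X]setTI; have := @measurable_itv R `]-oo, r].
apply: measurableT_comp => //; first exact: measurable_enorm.
exact: measurable_rV_affine.
Qed.

Lemma eball_coord n (x y : 'rV[R]_n) (r : R) i : eball x r y ->
  `|x ord0 i - y ord0 i| <= r.
Proof.
rewrite /eball/= => /(le_trans _); apply.
rewrite -sqrtr_sqr enormE ler_sqrt ?sqn_ge0// /sqn (bigD1 i)//= !mxE lerDl.
by apply: sumr_ge0 => j _; exact: sqr_ge0.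
Qed.

Lemma eball_fin n (x : 'rV[R]_n) (r : R) : (lebesgue_rV n (eball x r) < +oo)%E.
Proof.
pose A : 'I_n -> set (measurableTypeR R) :=
  fun i => `[x ord0 i - r, x ord0 i + r]%classic.
have mA i : measurable (A i) by exact: measurable_itv.
apply: (@le_lt_trans _ _ (lebesgue_rV n (rV_box A))).
  apply: le_measure; rewrite ?inE//; first exact: measurable_eball.
    exact: measurable_rV_box.
  move=> y xy i; rewrite /A/= in_itv/= -ler_distlC.
  by exact: eball_coord.
have -> : lebesgue_rV n (rV_box A) = (\prod_(i < n) lebesgue_measure (A i))%E.
  exact: lebesgue_rV_box.
rewrite ltey_eq; apply/orP; left; elim/big_ind : _ => [||i _].
- by [].
- by move=> u v; exact: fin_numM.
by rewrite /A/= lebesgue_measure_itv/=; case: ifP => // _; rewrite -EFinB.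
Qed.

Lemma continuous_sqn n : continuous (@sqn n).
Proof.
apply: (@continuous_big _ _ _ _ _ _ _ _ _ _) => [|i _].
  exact: add_continuous.
move=> v; apply: (@continuous_comp _ R R (fun v : 'rV[R]_n => v ord0 i) (fun a : R => a ^+ 2)).
  exact: coord_continuous.
exact: exprn_continuous.
Qed.

Lemma eball_compact n (x : 'rV[R]_n) (r : R) : compact (eball x r).
Proof.
apply: bounded_closed_compact.
  exists (`|x| + `|r|); split; first exact: num_real.
  move=> M rM y xy /=; rewrite [leLHS]/Num.Def.normr/= mx_normrE.
  apply: bigmax_le => [|[i j] _ /=].
    by apply/ltW/(le_lt_trans _ rM); rewrite addr_ge0.
  rewrite (ord1 i) -(subrKC (x ord0 j) (y ord0 j)).
  apply/ltW/(le_lt_trans _ rM)/(le_trans (ler_normD _ _))/lerD.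
    by rewrite [leRHS]/Num.Def.normr/= mx_normrE; apply: (le_bigmax _ _ (ord0, j)).
  rewrite distrC; apply: le_trans (eball_coord j xy) _; exact: ler_norm.
rewrite (_ : eball x r = ((@enorm R n) \o (fun y => x - y)) @^-1`
  [set a | a <= r])//.
apply: preimage_closed; last exact: closed_le.
move=> y _; apply: continuous_comp.
  by apply: continuousB; [exact: cst_continuous|exact: cvg_id].
apply: continuous_comp; first exact: continuous_sqn.
exact: sqrt_continuous.
Qed.

(** Compactness of the closed ball; nothing is known about [f] outside [U], so its bounds and its
    measurability are always taken on a ball inside [U]. *)
Lemma eball_bounded n (x : 'rV[R]_n) (r : R) (U : set 'rV[R]_n) (f : 'rV[R]_n -> R) :
  open U -> eball x r `<=` U -> (forall y, U y -> {for y, continuous f}) ->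
  exists M, forall y, eball x r y -> `|f y| <= M.
Proof.
move=> oU xrU cf.
have : compact (f @` eball x r).
  apply: continuous_compact; last exact: eball_compact.
  apply: (@continuous_subspaceW _ _ _ U) => //.
  by apply: continuous_in_subspaceT => y /set_mem Uy; exact: cf.
move=> /compact_bounded[M [_ MP]]; exists (M + 1) => y xy.
by apply: (MP (M + 1)); [rewrite ltrDl|exists y].
Qed.

End row_measurable.

(** * Integration of bounded functions and change of variables *)

Section integral_tools.
Local Open Scope ereal_scope.
Context d (T : measurableType d) (R : realType).

Lemma bounded_integrable (mu : {measure set T -> \bar R}) (A : set T)
    (f : T -> R) (M : R) :
  measurable A -> mu A < +oo -> measurable_fun A f ->
  (forall x, A x -> (`|f x| <= M)%R) -> mu.-integrable A (EFin \o f).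
Proof.
move=> mA Aoo mf fM; apply: measurable_bounded_integrable => //.
exists M; split; first exact: num_real.
by move=> K MK x /= Ax; apply: (le_trans (fM x Ax)); exact: ltW.
Qed.

(** Split into positive and negative parts; integrability makes the negative one finite, so the
    factor distributes over the difference. *)
Lemma integral_mscale (m : {measure set T -> \bar R}) (D : set T) (k : {nonneg R})
    (f : T -> \bar R) : measurable D -> m.-integrable D f ->
  \int[mscale k m]_(x in D) f x = k%:num%:E * \int[m]_(x in D) f x.
Proof.
move=> mD intf; have mf := measurable_int _ intf.
rewrite [LHS]integralE [X in _ * X]integralE.
rewrite (ge0_integral_mscale _ mD _ (measurable_funepos mf))//.
rewrite (ge0_integral_mscale _ mD _ (measurable_funeneg mf))//.
rewrite [RHS]muleBr//; apply: fin_num_adde_defl.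
by rewrite fin_numN; exact: integrable_neg_fin_num.
Qed.

End integral_tools.

Section row_integral.
Context {R : realType}.

Lemma integral_eball_affine n (x : 'rV[R]_n) (k M : R) (f : 'rV[R]_n -> R) :
  0 < k -> measurable_fun (eball x k) f ->
  (forall y, eball x k y -> `|f y| <= M) ->
  (\int[lebesgue_rV n]_(y in eball x k) (f y)%:E =
   (k ^+ n)%:E * \int[lebesgue_rV n]_(z in eball 0 1) (f (x + k *: z)%R)%:E)%E.
Proof.
move=> k0 mf fM.
have k0' : 0 <= k ^+ n by rewrite exprn_ge0// ltW.
have maff := measurable_rV_affine x k.
have [nu nuE] := pushforward_measure (lebesgue_rV n) maff.
have pre : (fun z : 'rV[R]_n => x + k *: z) @^-1` eball x k = eball 0 1.
  apply/seteqP; split => z /=; rewrite /eball/= opprD addNKr sub0r !enormN enormZ;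
  by rewrite gtr0_norm// ger_pMr.
have mB := measurable_eball x k.
(* Extension by zero gives a function measurable on the whole space, whose composition with the
   affine map is measurable as well. *)
pose g : 'rV[R]_n -> R := f \_ (eball x k).
have mg : measurable_fun setT g by apply/(measurable_restrictT _ mB).
have gM y : `|g y| <= `|M|.
  rewrite /g patchE; case: ifPn => [|_]; last by rewrite normr0.
  by move=> /set_mem /fM /le_trans; apply; exact: ler_norm.
have -> : (\int[lebesgue_rV n]_(y in eball x k) (f y)%:E =
   \int[lebesgue_rV n]_(y in eball x k) (g y)%:E)%E.
  by apply: eq_integral => y xy; rewrite /g patchE xy.
have nuoo : (nu (eball x k) < +oo)%E.
  by rewrite nuE pre; exact: eball_fin.
rewrite (@eq_measure_integral _ _ _ _ (mscale (NngNum k0') nu)); last first.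
  by move=> A mA _; rewrite /= /mscale/= nuE; exact: lebesgue_rV_affine.
rewrite integral_mscale//; last first.
  apply: (@bounded_integrable _ _ _ _ _ _ `|M|) => //.
  exact: measurable_funS mg.
congr (_ * _)%E => /=.
rewrite (@eq_measure_integral _ _ _ _
    (pushforward (lebesgue_rV n) (fun z : 'rV[R]_n => x + k *: z))); last first.
  by move=> A mA _; rewrite /= nuE.
rewrite integral_pushforward//; last 2 first.
- exact/measurable_EFinP.
- rewrite pre; apply: (@bounded_integrable _ _ _ _ _ (g \o (fun z => x + k *: z)) `|M|) => //.
  + exact: measurable_eball.
  + exact: eball_fin.
  + by apply: measurable_funTS; exact: measurableT_comp.
  + by move=> z _; exact: gM.
rewrite pre; apply: eq_integral => z; rewrite -pre => /set_mem/= xz.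
by rewrite /g patchE mem_set.
Qed.

Lemma integral_rV_ins n (i : 'I_n.+1) (f : 'rV[R]_n.+1 -> R) :
  measurable_fun setT f ->
  (lebesgue_rV n.+1).-integrable setT (EFin \o f) ->
  (\int[lebesgue_rV n.+1]_y (f y)%:E =
   \int[lebesgue_rV n]_v \int[lebesgue_measure]_a (f (rV_ins i (a, v)))%:E)%E.
Proof.
move=> mf intf.
have mi := @measurable_rV_ins R n i.
have intg : (@lebesgue_measure R \x lebesgue_rV n)%E.-integrable setT
    (EFin \o (f \o rV_ins i)).
  apply/integrableP; split.
    by apply/measurable_EFinP; exact: measurableT_comp.
  have /integrableP[_] := intf; rewrite /=.
  rewrite (@eq_measure_integral _ _ _ _
      (pushforward (@lebesgue_measure R \x lebesgue_rV n)%E (rV_ins i))); last first.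
    by move=> A mA _; apply/esym; exact: lebesgue_rV_ins.
  rewrite ge0_integral_pushforward//.
  by apply/measurable_EFinP; exact: measurableT_comp.
rewrite (integral21_prod_meas1 intg).
rewrite (@eq_measure_integral _ _ _ _
    (pushforward (@lebesgue_measure R \x lebesgue_rV n)%E (rV_ins i))); last first.
  by move=> A mA _; apply/esym; exact: lebesgue_rV_ins.
rewrite integral_pushforward//.
by exact/measurable_EFinP.
Qed.

End row_integral.

(** * Derivatives along lines and integration by parts on the unit ball *)

Section line_derivative.
Context {R : realType}.

(** Both difference quotients are the same function of [h]. This carries the one-variable chain
    rule, mean value theorem and fundamental theorem over to directional derivatives. *)
Lemma is_derive_line n (g : 'rV[R]_n -> R) (p v : 'rV[R]_n) (t d : R) :
  is_derive (p + t *: v) v g d <-> is_derive t 1 (fun u : R => g (p + u *: v)) d.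
Proof.
have E : (fun h : R => h^-1 *: (g (h *: v + (p + t *: v)) - g (p + t *: v))) =
   (fun h : R => h^-1 *: (g (p + (h *: 1 + t) *: v) - g (p + t *: v))).
  apply/funext => h; congr (_ *: (g _ - _)).
  by rewrite addrCA -scalerDl /GRing.scale/= mulr1.
split=> -[H1 H2]; split; move: H1 H2; rewrite /derivable /derive.
- by rewrite -E.
- by rewrite -E.
- by rewrite -E.
- by rewrite -E.
Qed.

Lemma is_derive_affine n (f : 'rV[R]_n -> R) (x z v : 'rV[R]_n) (k d : R) :
  is_derive (x + k *: z) v f d ->
  is_derive z v (fun u => f (x + k *: u)) (k * d).
Proof.
move=> H; have -> : z = z + 0 *: v by rewrite scale0r addr0.
apply/is_derive_line.
have -> : (fun u : R => f (x + k *: (z + u *: v))) =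
   (fun u => f ((x + k *: z) + u *: v)) \o (fun u => k * u).
  by apply/funext => u /=; rewrite scalerDr scalerA addrA.
rewrite mulrC; apply: is_derive1_comp.
  by apply/is_derive_line; rewrite mulr0 scale0r addr0.
have H2 : is_derive (0 : R) 1 (k \*: (id : R -> R)) (k *: 1) by exact: is_deriveZ.
by rewrite -[X in is_derive _ _ _ X]mulr1.
Qed.

Lemma continuous_line n (p v : 'rV[R]_n) : continuous (fun u : R => p + u *: v).
Proof.
move=> u; apply: cvgD; first exact: cvg_cst.
by apply: continuousZr_tmp; exact: cvg_id.
Qed.

End line_derivative.

Section ball_by_parts.
Context {R : realType}.

Lemma continuous_ball_integrable n (V : set 'rV[R]_n) (h : 'rV[R]_n -> R) r x :
  open V -> eball x r `<=` V -> (forall z, V z -> {for z, continuous h}) ->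
  (lebesgue_rV n).-integrable (eball x r) (EFin \o h).
Proof.
move=> oV BV ch; have [M hM] := eball_bounded oV BV ch.
apply: (@bounded_integrable _ _ _ _ _ h M) => //; first exact: measurable_eball.
  exact: eball_fin.
by apply: continuous_measurable_rV ch => //; exact: measurable_eball.
Qed.

Lemma continuous_weight n m : continuous (fun z : 'rV[R]_n => (1 - sqn z) ^+ m).
Proof.
move=> z.
apply: (@continuous_comp _ R R (fun z : 'rV[R]_n => 1 - sqn z) (fun y : R => y ^+ m)).
  by apply: continuousB; [exact: cst_continuous|exact: continuous_sqn].
exact: exprn_continuous.
Qed.

Lemma rV_insE n (i : 'I_n.+1) (a : R) (v : 'rV[R]_n) :
  rV_ins i (a, v) = rV_ins i (0, v) + a *: delta_mx 0 i.
Proof.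
apply/rowP => j; rewrite !mxE; have [k ->|->] := unliftP i j.
  by rewrite eq_sym (negPf (neq_lift i k)) andbF mulr0 addr0.
by rewrite !eqxx mulr1 add0r.
Qed.

Lemma sqn_ins n (i : 'I_n.+1) (a : R) (v : 'rV[R]_n) :
  sqn (rV_ins i (a, v)) = a ^+ 2 + sqn v.
Proof.
rewrite /sqn (bigD1_ord i)//= rV_ins_id; congr (_ + _).
by apply: eq_bigr => k _; rewrite rV_ins_lift.
Qed.

(* The integrand is the derivative of [- G * (b^2 - a^2)^(m+1)], which vanishes
   at both ends of the interval. *)
Lemma slice_by_parts (G dG : R -> R) (b : R) (m : nat) : 0 < b ->
  (forall a, a \in `[- b, b] -> is_derive a 1 G (dG a)) ->
  (forall a, a \in `[- b, b] -> {for a, continuous dG}) ->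
  (\int[lebesgue_measure]_(a in `[(- b)%R, b])
    (2 * m.+1%:R * G a * a * (b ^+ 2 - a ^+ 2) ^+ m
      - dG a * (b ^+ 2 - a ^+ 2) ^+ m.+1)%R%:E = 0)%E.
Proof.
move=> b0 dGE cdG.
pose P : R -> R := (cst (b ^+ 2) - id ^+ 2) ^+ m.+1.
have PE a : P a = (b ^+ 2 - a ^+ 2) ^+ m.+1 by rewrite /P !fctE.
pose F : R -> R := - (G * P).
have dF a : a \in `[- b, b] -> is_derive a 1 F
    (2 * m.+1%:R * G a * a * (b ^+ 2 - a ^+ 2) ^+ m
      - dG a * (b ^+ 2 - a ^+ 2) ^+ m.+1).
  move=> ab; have Ga := dGE _ ab.
  apply: is_derive_eq; rewrite /GRing.scale/= !fctE/=.
  rewrite -PE/P !fctE/= ; ring.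
have cF a : a \in `[- b, b] -> {for a, continuous F}.
  move=> ab; apply: differentiable_continuous; apply/derivable1_diffP.
  by have [] := dF _ ab.
have cG a : a \in `[- b, b] -> {for a, continuous G}.
  move=> ab; apply: differentiable_continuous; apply/derivable1_diffP.
  by have [] := dGE _ ab.
have bb : - b < b by rewrite gtrN.
rewrite (@continuous_FTC2 _ _ F)//.
- by rewrite /F !fctE/= !PE sqrrN subrr expr0n/= !mulr0 oppr0 subee.
- apply: continuous_in_subspaceT => a /set_mem/= ab.
  have cQ k : {for a, continuous (fun a : R => (b ^+ 2 - a ^+ 2) ^+ k)}.
    apply: (@continuous_comp _ R R (fun a : R => b ^+ 2 - a ^+ 2) (fun y : R => y ^+ k)).
      by apply: cvgB; [exact: cvg_cst|exact: exprn_continuous].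
    exact: exprn_continuous.
  apply: cvgB; last by apply: cvgM; [exact: cdG|exact: cQ].
  apply: cvgM; last exact: cQ.
  apply: cvgM; last exact: cvg_id.
  by apply: cvgM; [exact: cvg_cst|exact: cG].
- split=> [a ab||].
  + have [] // := dF a _; exact: subset_itv_oo_cc.
  + by apply: cvg_at_right_filter; apply: cF; rewrite in_itv/= lexx ltW.
  + by apply: cvg_at_left_filter; apply: cF; rewrite in_itv/= lexx ltW.
- move=> a ab; rewrite derive1E; have [] // := dF a _; exact: subset_itv_oo_cc.
Qed.

(** The [i]-th derivative of [(1 - |z|^2)^(m+1)] is [-2 (m+1) z_i (1 - |z|^2)^m]. With the [i]-th
    coordinate innermost, the difference of the two integrands integrates to 0 on every slice. *)
Lemma ball_by_parts n (i : 'I_n) (g dg : 'rV[R]_n -> R) (V : set 'rV[R]_n) (m : nat) :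
  open V -> eball 0 1 `<=` V ->
  (forall z, V z -> is_derive z (delta_mx 0 i : 'rV[R]_n) g (dg z)) ->
  (forall z, V z -> {for z, continuous g}) ->
  (forall z, V z -> {for z, continuous dg}) ->
  \int[lebesgue_rV n]_(z in eball 0 1)
     (2 * m.+1%:R * g z * z ord0 i * (1 - sqn z) ^+ m) =
  \int[lebesgue_rV n]_(z in eball 0 1) (dg z * (1 - sqn z) ^+ m.+1).
Proof.
move=> oV BV dgE cg cdg.
pose h1 z := 2 * m.+1%:R * g z * z ord0 i * (1 - sqn z) ^+ m.
pose h2 z := dg z * (1 - sqn z) ^+ m.+1.
have ch1 z : V z -> {for z, continuous h1}.
  move=> Vz; apply: continuousM; last exact: continuous_weight.
  apply: continuousM; last exact: coord_continuous.
  by apply: continuousM; [exact: cst_continuous|exact: cg].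
have ch2 z : V z -> {for z, continuous h2}.
  by move=> Vz; apply: continuousM; [exact: cdg|exact: continuous_weight].
have ih h : (forall z, V z -> {for z, continuous h}) ->
   (lebesgue_rV n).-integrable (eball 0 1) (EFin \o h).
  exact: continuous_ball_integrable.
have mB := @measurable_eball R n 0 1.
apply/eqP; rewrite -subr_eq0 -RintegralB//; [|exact: ih|exact: ih].
apply/eqP; rewrite /Rintegral.
have ch z : V z -> {for z, continuous (fun z => h1 z - h2 z)}.
  by move=> Vz; apply: continuousB; [exact: ch1|exact: ch2].
rewrite [X in fine X](_ : _ = 0%E)//.
rewrite integral_mkcond.
pose f : 'rV[R]_n -> R := (fun z => h1 z - h2 z) \_ (eball 0 1).
transitivity (\int[lebesgue_rV n]_z (f z)%:E)%E.
  by apply: eq_integral => z _; rewrite /f !patchE; case: ifP.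
have mf : measurable_fun setT f.
  apply/(measurable_restrictT _ mB).
  exact: continuous_measurable_rV ch.
(* Dimension 0 has no index [i]; in dimension [n+1] the remaining coordinates form a vector of
   length [n]. *)
case: n i g dg V oV BV dgE cg cdg @h1 @h2 ch1 ch2 ih mB ch @f mf.
  by case.
move=> n i g dg V oV BV dgE cg cdg h1 h2 ch1 ch2 ih mB ch f mf.
rewrite (@integral_rV_ins _ _ i)//; last first.
  have := (integrable_mkcond _ mB).1 (ih _ ch).
  by rewrite restrict_EFin.
apply: integral0_eq => v _.
have fE a : f (rV_ins i (a, v)) = if a ^+ 2 + sqn v <= 1 then
    2 * m.+1%:R * g (rV_ins i (a, v)) * a * (1 - sqn v - a ^+ 2) ^+ m
      - dg (rV_ins i (a, v)) * (1 - sqn v - a ^+ 2) ^+ m.+1 else 0.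
  rewrite /f patchE /h1 /h2 rV_ins_id sqn_ins opprD [- _ - _]addrC addrA.
  case: ifPn => [/set_mem/eball01E|]; first by rewrite sqn_ins => ->.
  by rewrite notin_setE => /eball01E; rewrite sqn_ins => /negP/negbTE ->.
under eq_integral do rewrite fE.
(* Here the slice is empty or reduces to [a = 0] with [|v| = 1]. At that point the second term
   vanishes by its weight, and the first by its factor [a], which matters for [m = 0]. *)
have [v1|v1] := leP 1 (sqn v).
  apply: integral0_eq => a _; case: ifPn => // av.
  have a0 : a = 0.
    by apply/eqP; rewrite -sqrf_eq0 eq_le sqr_ge0 andbT; lra.
  have -> : sqn v = 1 by move: av; rewrite a0 expr0n/=; lra.
  by rewrite a0 mulr0 mul0r subrr expr0n subrr/= expr0n/= mulr0 subrr.
(* Half the length of the slice. *)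
pose b := Num.sqrt (1 - sqn v).
have b2 : b ^+ 2 = 1 - sqn v by rewrite sqr_sqrtr//; lra.
have b0 : 0 < b by rewrite sqrtr_gt0; lra.
have abE a : (a ^+ 2 + sqn v <= 1) = (a \in `[- b, b]).
  rewrite in_itv/= -ler_norml -[RHS]ler_sqr ?nnegrE ?normr_ge0 ?sqrtr_ge0//.
  by rewrite real_normK ?num_real// b2 lerBrDr.
have Vab a : a \in `[- b, b] -> V (rV_ins i (a, v)).
  by rewrite -abE => ab; apply: BV; apply/eball01E; rewrite sqn_ins.
rewrite -[RHS](@slice_by_parts (fun a => g (rV_ins i (a, v)))
    (fun a => dg (rV_ins i (a, v))) b m)//.
- rewrite [RHS]integral_mkcond; apply: eq_integral => a _.
  rewrite patchE mem_setE abE b2; by case: ifP.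
- move=> a ab; under eq_fun do rewrite rV_insE.
  by apply/is_derive_line; rewrite -rV_insE; exact/dgE/Vab.
- move=> a ab; apply: (@continuous_comp _ _ _ (fun u => rV_ins i (u, v)) dg).
    have := @continuous_line R _ (rV_ins i (0, v)) (delta_mx 0 i) a.
    by rewrite /prop_for /continuous_at -rV_insE; under eq_fun do rewrite -rV_insE.
  exact/cdg/Vab.
Qed.

End ball_by_parts.

(** * Directional derivatives from continuous partial derivatives *)

Section directional_derivative.
Context {R : realType}.

Lemma is_deriveP n (f : 'rV[R]_n -> R) (y v : 'rV[R]_n) (a : R) :
  is_derive y v f a <->
  h^-1 *: (f (h *: v + y) - f y) @[h --> (0 : R)^'] --> a.
Proof.
split=> [[df <-]|fa]; first exact: df.
have cf : derivable f y v by apply/cvg_ex; exists a.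
by split => //; exact: cvg_lim.
Qed.

Lemma is_derive_dirZ n (f : 'rV[R]_n -> R) (y v : 'rV[R]_n) (a c : R) :
  is_derive y v f a -> is_derive y (c *: v) f (c * a).
Proof.
move=> fa; have {}fa : is_derive (y + 0 *: v) v f a by rewrite scale0r addr0.
have -> : y = y + 0 *: (c *: v) by rewrite scale0r addr0.
move/is_derive_line in fa; apply/is_derive_line.
have -> : (fun u : R => f (y + u *: (c *: v))) =
   (fun u => f (y + u *: v)) \o (fun u => c * u).
  by apply/funext => u /=; rewrite scalerA mulrC.
rewrite mulrC; apply: is_derive1_comp; first by rewrite mulr0.
have H2 : is_derive (0 : R) 1 (c \*: (id : R -> R)) (c *: 1) by exact: is_deriveZ.
by rewrite -[X in is_derive _ _ _ X]mulr1.
Qed.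

(** The increment is split along the broken path [y], [y + h v], [y + h v + h w]. The first leg
    gives [a]; on the second the mean value theorem produces [dw] at an intermediate point, which
    tends to [y], and continuity of [dw] concludes. The directions play unequal roles: [v] is used
    at [y] only, [w] on a neighbourhood. *)
Lemma is_derive_dirD n (f dw : 'rV[R]_n -> R) (V : set 'rV[R]_n)
    (y v w : 'rV[R]_n) (a : R) :
  open V -> V y -> is_derive y v f a ->
  (forall z, V z -> is_derive z w f (dw z)) -> {for y, continuous dw} ->
  is_derive y (v + w) f (a + dw y).
Proof.
move=> oV Vy /is_deriveP fa dwE cdw; apply/is_deriveP.
have -> : (fun h : R => h^-1 *: (f (h *: (v + w) + y) - f y)) =
   (fun h => h^-1 *: (f (h *: v + y) - f y)) \+
   (fun h => h^-1 *: (f (h *: w + (h *: v + y)) - f (h *: v + y))).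
  apply/funext => h /=; rewrite -scalerDr; congr (_ *: _).
  by rewrite [RHS]addrC addrA subrK scalerDr [_ *: v + _]addrC addrA.
apply: cvgD; first exact: fa.
apply/cvgrPdist_lt => e e0.
have : nbhs y (V `&` [set z | `|dw y - dw z| < e]).
  apply: filterI; first exact: open_nbhs_nbhs.
  by move/cvgrPdist_lt : cdw; apply.
move=> /nbhs_ballP[d /= d0 dV].
near=> h.
have h0 : h != 0 by near: h; exact: nbhs_dnbhs_neq.
(* This keeps the whole second leg inside the ball where [dw] is within [e] of [dw y]. *)
have hd : `|h| * (`|v| + `|w|) < d.
  have K0 : 0 < `|v| + `|w| + 1 by rewrite ltr_wpDl// addr_ge0.
  have hK : `|h| < d / (`|v| + `|w| + 1).
    by near: h; apply: dnbhs0_lt; exact: divr_gt0.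
  apply: le_lt_trans (_ : `|h| * (`|v| + `|w| + 1) < d).
    by rewrite ler_wpM2l// lerDl.
  by rewrite -ltr_pdivlMr.
have inb (t : R) : t \in `[0, 1] -> ball y d (h *: v + y + (h * t) *: w).
  rewrite in_itv/= => /andP[t0 t1].
  rewrite -ball_normE/= [h *: v + y]addrC -addrA opprD addNKr normrN.
  apply: le_lt_trans (ler_normD _ _) _; rewrite !normrZ ?normrM.
  apply: le_lt_trans hd; rewrite mulrDr lerD2l ler_wpM2r// ler_piMr//.
  by rewrite ger0_norm.
(* [psi] runs through the second leg for [t] in [[0, 1]]; its derivative carries a factor [h] that
   cancels the [h^-1] of the difference quotient. *)
pose psi (t : R) := f (h *: v + y + (h * t) *: w).
have dpsi (t : R) : t \in `[0, 1] ->
    is_derive t 1 psi (dw (h *: v + y + (h * t) *: w) * h).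
  move=> t01; have -> : psi =
      (fun u => f (h *: v + y + u *: w)) \o (fun u => h * u) by [].
  apply: is_derive1_comp.
    by apply/is_derive_line; apply: dwE; have [] := dV _ (inb _ t01).
  have H2 : is_derive t 1 (h \*: (id : R -> R)) (h *: 1) by exact: is_deriveZ.
  by rewrite -[X in is_derive _ _ _ X]mulr1.
have cpsi : {within `[0, 1], continuous psi}.
  apply: continuous_in_subspaceT => t /set_mem/= t01.
  apply: differentiable_continuous; apply/derivable1_diffP.
  by have [] := dpsi _ t01.
have dpsi' (t : R) (t01 : t \in `]0, 1[) := dpsi t (subset_itv_oo_cc t01).
have [c c01 E] := MVT ltr01 dpsi' cpsi.
have psi1 : psi 1 = f (h *: w + (h *: v + y)) by rewrite /psi mulr1 addrC.
have psi0 : psi 0 = f (h *: v + y) by rewrite /psi mulr0 scale0r addr0.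
rewrite -psi1 -psi0 E subr0 mulr1 /GRing.scale/= mulrC mulfK//.
by have [] := dV _ (inb _ (subset_itv_oo_cc c01)).
Unshelve. all: by end_near. Qed.

Lemma is_derive_partials n (f : 'rV[R]_n -> R) (df : 'I_n -> 'rV[R]_n -> R)
    (V : set 'rV[R]_n) (y v : 'rV[R]_n) :
  open V -> V y ->
  (forall z i, V z -> is_derive z (delta_mx 0 i : 'rV[R]_n) f (df i z)) ->
  (forall z i, V z -> {for z, continuous (df i)}) ->
  is_derive y v f (\sum_(i < n) v ord0 i * df i y).
Proof.
move=> oV Vy dfE cdf.
suff H (s : seq 'I_n) : is_derive y (\sum_(i <- s) v ord0 i *: (delta_mx 0 i : 'rV[R]_n))
    f (\sum_(i <- s) v ord0 i * df i y).
  by rewrite {1}(row_sum_delta v); exact: H.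
elim: s => [|i s IH].
  rewrite !big_nil; apply/is_deriveP.
  rewrite (_ : (fun _ => _) = cst 0); first exact: cvg_cst.
  by apply/funext => h; rewrite scaler0 add0r subrr scaler0.
(* The sum is swapped so that the new coordinate direction takes the role of [w], its derivative
   being known throughout [V], while the partial sum is differentiated at [y] only. *)
rewrite !big_cons addrC [X in is_derive _ _ _ X]addrC.
apply: (@is_derive_dirD _ f (fun z => v ord0 i * df i z) V) => //.
  by move=> z Vz; apply: is_derive_dirZ; exact: dfE.
by apply: continuousM; [exact: cst_continuous|exact: cdf].
Qed.

End directional_derivative.

(** * Fubini for bounded functions on a rectangle of finite measure *)

Section bounded_fubini.
Context d1 d2 (T1 : measurableType d1) (T2 : measurableType d2) (R : realType).

(** Boundedness on a set of finite measure gives integrability for the product measure, and also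
    makes every inner integral finite, so that the extended-real Fubini theorem descends to
    real-valued integrals. The first conjunct supplies the integrability of ball means as functions
    of the radius. *)
Lemma bounded_Fubini (m1 : {sigma_finite_measure set T1 -> \bar R})
    (m2 : {sigma_finite_measure set T2 -> \bar R}) (A : set T1) (B : set T2)
    (f : T1 * T2 -> R) (M : R) :
  measurable A -> measurable B -> (m1 A < +oo)%E -> (m2 B < +oo)%E ->
  measurable_fun (A `*` B) f ->
  (forall x y, A x -> B y -> `|f (x, y)| <= M) ->
  m1.-integrable A (EFin \o (fun x => \int[m2]_(y in B) f (x, y))) /\
  \int[m1]_(x in A) (\int[m2]_(y in B) f (x, y)) =
  \int[m2]_(y in B) (\int[m1]_(x in A) f (x, y)).
Proof.
move=> mA mB Aoo Boo mf fM.
have mAB : measurable (A `*` B) by exact: measurableX.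
pose g : T1 * T2 -> R := f \_ (A `*` B).
have ig : (m1 \x m2)%E.-integrable setT (EFin \o g).
  have := @bounded_integrable _ _ R (m1 \x m2)%E (A `*` B) f M mAB.
  move=> /(_ _ mf) H; have {}H := H _ _.
  rewrite /g -restrict_EFin; apply/(integrable_mkcond _ mAB); apply: H.
    by rewrite [X in (X < _)%E]product_measure1E// lte_mul_pinfty// ge0_fin_numE.
  by move=> [x y] [/= Ax By]; exact: fM.
have gE x y : g (x, y) = if (x \in A) && (y \in B) then f (x, y) else 0.
  rewrite /g patchE; congr (if _ then _ else _).
  apply/idP/andP => [/set_mem[/= ? ?]|[/set_mem ? /set_mem ?]].
    by split; exact: mem_set.
  exact: mem_set.
have mg : measurable_fun setT g by apply/(measurable_restrictT _ mAB).
have mfx x : A x -> measurable_fun B (fun y => f (x, y)).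
  move=> Ax; apply: (@eq_measurable_fun _ _ _ _ _ (fun y => g (x, y))).
    by move=> y yB; rewrite gE (mem_set Ax) yB.
  by apply: measurable_funTS; exact: measurable_fun_pair2.
have mfy y : B y -> measurable_fun A (fun x => f (x, y)).
  move=> By; apply: (@eq_measurable_fun _ _ _ _ _ (fun x => g (x, y))).
    by move=> x xA; rewrite gE (mem_set By) xA.
  by apply: measurable_funTS; exact: measurable_fun_pair1.
have inx x : A x -> (\int[m2]_(y in B) f (x, y))%:E = (\int[m2]_(y in B) (f (x, y))%:E)%E.
  move=> Ax; rewrite /Rintegral fineK//; apply: integrable_fin_num => //.
  by apply: (@bounded_integrable _ _ _ _ _ _ M) => //; [exact: mfx|move=> y; exact: fM].
have iny y : B y -> (\int[m1]_(x in A) f (x, y))%:E = (\int[m1]_(x in A) (f (x, y))%:E)%E.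
  move=> By; rewrite /Rintegral fineK//; apply: integrable_fin_num => //.
  apply: (@bounded_integrable _ _ _ _ _ _ M) => //; [exact: mfy|move=> x Ax; exact: fM].
have gF x : A x -> (\int[m2]_y (g (x, y))%:E = (\int[m2]_(y in B) f (x, y))%:E)%E.
  move=> Ax; rewrite inx// [RHS]integral_mkcond; apply: eq_integral => y _.
  by rewrite gE patchE (mem_set Ax)/=; case: ifP.
split.
  apply: (@eq_integrable _ _ _ _ A mA (fun x => \int[m2]_y (g (x, y))%:E)%E).
    by move=> x /set_mem; exact: gF.
  by apply: (@integrableS _ _ _ _ setT) => //; exact: (integrable_fubini_F ig).
rewrite /Rintegral; congr fine.
transitivity (\int[m1]_x \int[m2]_y (g (x, y))%:E)%E.
  rewrite integral_mkcond; apply: eq_integral => x _; rewrite patchE.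
  case: ifPn => [/set_mem Ax|nAx].
    by rewrite gF.
  rewrite integral0_eq// => y _.
  by rewrite gE (negPf nAx).
rewrite (Fubini ig) [RHS]integral_mkcond; apply: eq_integral => y _; rewrite patchE.
case: ifPn => [/set_mem By|nBy].
  rewrite iny// [RHS]integral_mkcond; apply: eq_integral => x _.
  by rewrite [LHS]/= gE patchE (mem_set By) andbT; case: ifP.
rewrite integral0_eq// => x _.
by rewrite /= gE (negPf nBy) andbF.
Qed.

End bounded_fubini.

(** * Means over balls *)

Section ball_mean.
Context {R : realType}.

(** The [G_m(rho)] of the overview: the domain is the fixed unit ball, [rho] enters through the
    argument of [phi] alone, and there is no division by a volume. *)
Definition ball_mean n (phi : 'rV[R]_n -> R) (x : 'rV[R]_n) (m : nat) (rho : R) : R :=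
  \int[lebesgue_rV n]_(z in eball 0 1) (phi (x + rho *: z) * (1 - sqn z) ^+ m).

Definition ball_moment n (m : nat) : R :=
  \int[lebesgue_rV n]_(z in eball (0 : 'rV[R]_n) 1) (1 - sqn z) ^+ m.

Lemma eball_affine n (x z : 'rV[R]_n) (t r : R) : 0 <= t <= r ->
  eball 0 1 z -> eball x r (x + t *: z).
Proof.
move=> /andP[t0 tr]; rewrite /eball/= sub0r opprD addNKr !enormN enormZ ger0_norm//.
by move=> z1; apply: le_trans tr; rewrite ler_piMr.
Qed.

Lemma continuous_affine n (x : 'rV[R]_n) (t : R) :
  continuous (fun z : 'rV[R]_n => x + t *: z).
Proof.
move=> z; apply: continuousD; first exact: cst_continuous.
by apply: continuousZl_tmp; exact: cvg_id.
Qed.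

Lemma open_affine n (x : 'rV[R]_n) (t : R) (U : set 'rV[R]_n) : open U ->
  open [set z | U (x + t *: z)].
Proof. by move=> oU; apply: open_comp => // z _; exact: continuous_affine. Qed.

Lemma C2_on_is_derive n (U : set 'rV[R]_n) (phi : 'rV[R]_n -> R) y i :
  C2_on U phi -> U y -> is_derive y (delta_mx 0 i : 'rV[R]_n) phi (partial i phi y).
Proof. by move=> /(_ y) H /H[_ /(_ i)[d _] _]; exact: derivableP. Qed.

Lemma C2_on_is_derive2 n (U : set 'rV[R]_n) (phi : 'rV[R]_n -> R) y i j :
  C2_on U phi -> U y -> is_derive y (delta_mx 0 j : 'rV[R]_n)
    (partial i phi) (partial j (partial i phi) y).
Proof. by move=> /(_ y) H /H[_ _ /(_ i j)[d _]]; exact: derivableP. Qed.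

Lemma integrable_sum_seq d (T : measurableType d) (mu : {measure set T -> \bar R})
    (D : set T) (I : Type) (s : seq I) (f : I -> T -> R) :
  measurable D -> (forall i, mu.-integrable D (EFin \o f i)) ->
  mu.-integrable D (EFin \o (fun x => \sum_(i <- s) f i x)).
Proof.
move=> mD intf; elim: s => [|i s IH].
  rewrite (_ : _ \o _ = cst 0%E); first exact: integrable0.
  by apply/funext => x /=; rewrite big_nil.
rewrite (_ : _ \o _ = (EFin \o f i) \+ (EFin \o (fun x => \sum_(i <- s) f i x))).
  exact: integrableD.
by apply/funext => x /=; rewrite big_cons.
Qed.

Lemma Rintegral_sum d (T : measurableType d) (mu : {measure set T -> \bar R})
    (D : set T) (I : Type) (s : seq I) (f : I -> T -> R) :
  measurable D -> (forall i, mu.-integrable D (EFin \o f i)) ->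
  \int[mu]_(x in D) (\sum_(i <- s) f i x) = \sum_(i <- s) \int[mu]_(x in D) f i x.
Proof.
move=> mD intf; elim: s => [|i s IH].
  rewrite big_nil; under eq_Rintegral do rewrite big_nil.
  by rewrite /Rintegral integral0_eq.
under eq_Rintegral do rewrite big_cons.
by rewrite RintegralD// ?big_cons ?IH//; exact: integrable_sum_seq.
Qed.

(** [ball_by_parts] is applied to each [partial i phi (x + t z)], whose [i]-th derivative in [z] is
    [t] times a pure second derivative of [phi]. Summing over [i] produces [t] times the Laplacian,
    hence [- lambda t phi]. *)
Lemma ball_mean_radial n (U : set 'rV[R]_n) (phi : 'rV[R]_n -> R) (lambda r t : R)
    (x : 'rV[R]_n) (m : nat) :
  open U -> eball x r `<=` U -> C2_on U phi ->
  (forall y, U y -> - laplacian phi y = lambda * phi y) ->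
  0 <= t <= r ->
  \int[lebesgue_rV n]_(z in eball 0 1)
     ((\sum_(i < n) z ord0 i * partial i phi (x + t *: z)) * (1 - sqn z) ^+ m)
  = - (lambda / (2 * m.+1%:R)) * (t * ball_mean phi x m.+1 t).
Proof.
move=> oU BU C2 eig t01.
pose V := [set z | U (x + t *: z)].
have oV : open V by exact: open_affine.
have BV : eball 0 1 `<=` V by move=> z Bz; apply/BU/eball_affine.
have cphi z : V z -> {for z, continuous (fun z : 'rV[R]_n => phi (x + t *: z))}.
  move=> Vz; apply: (continuous_comp (@continuous_affine _ x t z)).
  by have [] := C2 _ Vz.
have cd i z : V z -> {for z, continuous (fun z : 'rV[R]_n => partial i phi (x + t *: z))}.
  move=> Vz; apply: (continuous_comp (@continuous_affine _ x t z)).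
  by have [_ /(_ i)[]] := C2 _ Vz.
have cdd i z : V z ->
    {for z, continuous (fun z : 'rV[R]_n => t * partial i (partial i phi) (x + t *: z))}.
  move=> Vz; apply: continuousM; first exact: cst_continuous.
  apply: (continuous_comp (@continuous_affine _ x t z)).
  by have [_ _ /(_ i i)[]] := C2 _ Vz.
have mB := @measurable_eball R n 0 1.
have m2 : 2 * m.+1%:R != 0 :> R by rewrite mulf_neq0// pnatr_eq0.
have int1 i : (lebesgue_rV n).-integrable (eball 0 1) (EFin \o
    (fun z : 'rV[R]_n => z ord0 i * partial i phi (x + t *: z) * (1 - sqn z) ^+ m)).
  apply: (continuous_ball_integrable oV BV) => z Vz.
  apply: continuousM; last exact: continuous_weight.
  by apply: continuousM; [exact: coord_continuous|exact: cd].
have int2 i : (lebesgue_rV n).-integrable (eball 0 1) (EFin \o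
    (fun z : 'rV[R]_n => t * partial i (partial i phi) (x + t *: z) * (1 - sqn z) ^+ m.+1)).
  apply: (continuous_ball_integrable oV BV) => z Vz.
  by apply: continuousM; [exact: cdd|exact: continuous_weight].
have int3 : (lebesgue_rV n).-integrable (eball 0 1) (EFin \o
    (fun z : 'rV[R]_n => phi (x + t *: z) * (1 - sqn z) ^+ m.+1)).
  apply: (continuous_ball_integrable oV BV) => z Vz.
  by apply: continuousM; [exact: cphi|exact: continuous_weight].
under eq_Rintegral do rewrite mulr_suml.
rewrite Rintegral_sum//.
have E i : \int[lebesgue_rV n]_(z in eball 0 1)
     (z ord0 i * partial i phi (x + t *: z) * (1 - sqn z) ^+ m) =
   (2 * m.+1%:R)^-1 * \int[lebesgue_rV n]_(z in eball 0 1)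
     (t * partial i (partial i phi) (x + t *: z) * (1 - sqn z) ^+ m.+1).
  have dE z : V z -> is_derive z (delta_mx 0 i : 'rV[R]_n)
      (fun z => partial i phi (x + t *: z)) (t * partial i (partial i phi) (x + t *: z)).
    by move=> Vz; apply: is_derive_affine; exact: C2_on_is_derive2 C2 Vz.
  rewrite -(ball_by_parts m oV BV dE (cd i) (cdd i)).
  rewrite -[LHS](mulKf m2) -RintegralZl//; congr (_ * _).
  by apply: eq_Rintegral => z _; ring.
under eq_bigr do rewrite E.
rewrite -mulr_sumr -Rintegral_sum// /ball_mean.
have -> : \int[lebesgue_rV n]_(z in eball 0 1)
    (\sum_(i < n) t * partial i (partial i phi) (x + t *: z) * (1 - sqn z) ^+ m.+1)
  = - (lambda * t) *
    \int[lebesgue_rV n]_(z in eball 0 1) (phi (x + t *: z) * (1 - sqn z) ^+ m.+1).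
  rewrite -RintegralZl//; apply: eq_Rintegral => z /set_mem /BV Vz.
  rewrite -mulr_suml -mulr_sumr -/(laplacian phi (x + t *: z)).
  rewrite -[laplacian _ _]opprK eig//; ring.
by field.
Qed.

(** Fundamental theorem of calculus on the segment from [x] to [x + rho z]; the integrand is the
    derivative in direction [z], written through partial derivatives by [is_derive_partials]. *)
Lemma ball_line n (U : set 'rV[R]_n) (phi : 'rV[R]_n -> R) (r rho : R)
    (x z : 'rV[R]_n) :
  open U -> eball x r `<=` U -> C2_on U phi ->
  0 < rho <= r -> eball 0 1 z ->
  lebesgue_measure.-integrable `[0, rho] (EFin \o
     (fun t => \sum_(i < n) z ord0 i * partial i phi (x + t *: z))) /\
  \int[lebesgue_measure]_(t in `[0, rho])
     (\sum_(i < n) z ord0 i * partial i phi (x + t *: z)) =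
  phi (x + rho *: z) - phi x.
Proof.
move=> oU BU C2 /andP[rho0 rhor] Bz.
have inU t : t \in `[0, rho] -> U (x + t *: z).
  rewrite in_itv/= => /andP[t0 t1]; apply/BU/eball_affine => //.
  by rewrite t0 (le_trans t1).
pose F t := phi (x + t *: z).
have dF t : t \in `[0, rho] ->
    is_derive t 1 F (\sum_(i < n) z ord0 i * partial i phi (x + t *: z)).
  move=> /inU Ut; apply/is_derive_line.
  apply: (@is_derive_partials _ _ _ (fun i => partial i phi) U) => //.
    by move=> y i Uy; exact: C2_on_is_derive C2 Uy.
  by move=> y i Uy; have [_ /(_ i)[]] := C2 _ Uy.
have cF t : t \in `[0, rho] -> {for t, continuous F}.
  move=> tr; apply: differentiable_continuous; apply/derivable1_diffP.
  by have [] := dF _ tr.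
have cS : {within `[0, rho], continuous
    (fun t : R => \sum_(i < n) z ord0 i * partial i phi (x + t *: z))}.
  apply: continuous_in_subspaceT => t /set_mem/= tr.
  apply: cvg_big => [|i _]; first exact: add_continuous.
  apply: cvgM; first exact: cvg_cst.
  apply: (@continuous_comp _ _ _ (fun u : R => x + u *: z) (partial i phi)).
    exact: continuous_line.
  by have [_ /(_ i)[]] := C2 _ (inU _ tr).
split.
  by apply: continuous_compact_integrable => //; exact: segment_compact.
rewrite /Rintegral (@continuous_FTC2 _ _ F)//.
- by rewrite /F scale0r addr0 -EFinB.
- split=> [t tr||].
  + have [] // := dF t _; exact: subset_itv_oo_cc.
  + by apply: cvg_at_right_filter; apply: cF; rewrite in_itv/= lexx ltW.
  + by apply: cvg_at_left_filter; apply: cF; rewrite in_itv/= lexx ltW.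
- move=> t tr; rewrite derive1E; have [] // := dF t _; exact: subset_itv_oo_cc.
Qed.

End ball_mean.

Section ball_mean_step.
Context {R : realType}.

Lemma weight_bound n (z : 'rV[R]_n) m : eball 0 1 z -> `|(1 - sqn z) ^+ m| <= 1.
Proof.
move=> /eball01E z1; have z0 := sqn_ge0 z.
by rewrite ger0_norm ?exprn_ge0 ?exprn_ile1//; lra.
Qed.

Lemma measurable_weight n m : measurable_fun setT (fun z : 'rV[R]_n => (1 - sqn z) ^+ m).
Proof.
apply: measurable_funX; apply: measurable_funB; first exact: measurable_cst.
exact: measurable_sqn.
Qed.

Lemma measurable_line n (x : 'rV[R]_n) :
  measurable_fun setT (fun p : R * 'rV[R]_n => x + p.1 *: p.2).
Proof.
apply: measurable_fun_rVP => i.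
rewrite (_ : (fun _ => _) = (fun p : R * 'rV[R]_n => x ord0 i + p.1 * p.2 ord0 i)).
  apply: measurable_funD; first exact: measurable_cst.
  apply: measurable_funM; first exact: measurable_fst.
  by apply: (measurableT_comp (measurable_coord i)).
by apply/funext => p; rewrite !mxE.
Qed.

Lemma measurable_cone n (x : 'rV[R]_n) (r rho : R) (f : 'rV[R]_n -> R) :
  rho <= r -> measurable_fun (eball x r) f ->
  measurable_fun (`[0, rho]%classic `*` eball 0 1)
    (fun p : R * 'rV[R]_n => f (x + p.1 *: p.2)).
Proof.
move=> rhor mf; pose g : 'rV[R]_n -> R := f \_ (eball x r).
have mg : measurable_fun setT g.
  by apply/(measurable_restrictT _ (measurable_eball x r)).
apply: (@eq_measurable_fun _ _ _ _ _ (fun p : R * 'rV[R]_n => g (x + p.1 *: p.2))).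
  move=> [t z] /set_mem[/=]; rewrite in_itv/= => /andP[t0 t1] Bz.
  rewrite /g patchE mem_set//; apply: eball_affine => //.
  by rewrite t0 (le_trans t1).
apply: measurable_funTS; apply: (measurableT_comp mg); exact: measurable_line.
Qed.

(** On the unit ball the weights lie in [[0, 1]], so one constant [M] serves for all [m]. The
    remainder estimate depends on this uniformity, since each iteration raises [m]. *)
Lemma ball_mean_integrable n (U : set 'rV[R]_n) (phi : 'rV[R]_n -> R) (r : R)
    (x : 'rV[R]_n) :
  open U -> eball x r `<=` U -> (forall y, U y -> {for y, continuous phi}) ->
  exists2 M, forall m t, t \in `[0, r] -> `|ball_mean phi x m t| <= M &
  forall m, lebesgue_measure.-integrable `[0, r] (EFin \o ball_mean phi x m).
Proof.
move=> oU BU cphi.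
have [M MP] := eball_bounded oU BU cphi.
have mB := @measurable_eball R n 0 1.
have fM m t z : `[0, r]%classic t -> eball 0 1 z ->
    `|phi (x + t *: z) * (1 - sqn z) ^+ m| <= M.
  rewrite /= in_itv/= => t0r Bz; rewrite normrM -[leRHS]mulr1.
  rewrite ler_pM ?normr_ge0 ?weight_bound//.
  by apply: MP; apply: eball_affine.
have mphi : measurable_fun (eball x r) phi.
  by apply: (continuous_measurable_rV oU) => //; exact: measurable_eball.
have fin0r : (lebesgue_measure `[0%R, r]%classic < +oo)%E.
  by rewrite /= lebesgue_measure_itv/=; case: ifP => _; rewrite ?ltry// -EFinB ltry.
exists (M * fine (lebesgue_rV n (eball 0 1))) => [m t t0r|m]; last first.
  pose f (p : R * 'rV[R]_n) := phi (x + p.1 *: p.2) * (1 - sqn p.2) ^+ m.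
  have mf : measurable_fun (`[0, r]%classic `*` eball 0 1) f.
    apply: measurable_funM; first exact: measurable_cone mphi.
    by apply: measurable_funTS; apply: (measurableT_comp (measurable_weight m)).
  have m0r : measurable `[0, r]%classic by exact: measurable_itv.
  have [] // := bounded_Fubini (m1 := @lebesgue_measure R) (m2 := lebesgue_rV n)
    m0r mB fin0r (eball_fin 0 1) mf (fM m).
have ct z : [set z | U (x + t *: z)] z ->
    {for z, continuous (fun z : 'rV[R]_n => phi (x + t *: z))}.
  move=> Vz; apply: (continuous_comp (@continuous_affine _ _ x t z)); exact: cphi.
have it : (lebesgue_rV n).-integrable (eball 0 1) (EFin \o
    (fun z : 'rV[R]_n => phi (x + t *: z) * (1 - sqn z) ^+ m)).
  apply: (continuous_ball_integrable (@open_affine _ _ x t _ oU)).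
    by move=> z Bz; apply/BU/eball_affine.
  by move=> z Vz; apply: continuousM; [exact: ct|exact: continuous_weight].
apply: le_trans (le_normr_Rintegral _ _) _ => //.
have -> : M * fine (lebesgue_rV n (eball 0 1)) =
  \int[lebesgue_rV n]_(z in eball 0 1) M.
  by rewrite Rintegral_cst.
apply: le_Rintegral => //; first exact: integrable_norm.
  apply: (@bounded_integrable _ _ _ _ _ (fun=> M) `|M|) => //.
  exact: eball_fin.
by move=> z Bz; exact: fM.
Qed.

Lemma ball_mean_mul_integrable n (U : set 'rV[R]_n) (phi : 'rV[R]_n -> R) (r : R)
    (x : 'rV[R]_n) (m : nat) :
  open U -> eball x r `<=` U -> (forall y, U y -> {for y, continuous phi}) ->
  lebesgue_measure.-integrable `[0, r] (EFin \o (fun t => t * ball_mean phi x m t)).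
Proof.
move=> oU BU cphi; have [M bM iM] := ball_mean_integrable oU BU cphi.
apply: (@bounded_integrable _ _ _ _ _ _ (r * M)) => //.
- by rewrite /= lebesgue_measure_itv/=; case: ifP => _; rewrite ?ltry// -EFinB ltry.
- apply: measurable_funM; first exact: measurable_id.
  by have /measurable_EFinP := measurable_int _ (iM m).
- move=> t t0r; have := t0r; rewrite /= in_itv/= => /andP[t0 tr].
  by rewrite normrM ler_pM ?normr_ge0 ?bM// ger0_norm.
Qed.

(* Integrate the radial derivative of [phi], swap the integrals, and use
   [(1 - |z|^2)^m z = - grad (1 - |z|^2)^(m+1) / (2 (m + 1))] to turn the radial
   derivative into a Laplacian. *)
Lemma ball_mean_step n (U : set 'rV[R]_n) (phi : 'rV[R]_n -> R) (lambda r rho : R)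
    (x : 'rV[R]_n) (m : nat) :
  open U -> eball x r `<=` U -> C2_on U phi ->
  (forall y, U y -> - laplacian phi y = lambda * phi y) ->
  0 <= rho <= r ->
  ball_mean phi x m rho = ball_moment n m * phi x
    - lambda / (2 * m.+1%:R) *
      \int[lebesgue_measure]_(t in `[0, rho]) (t * ball_mean phi x m.+1 t).
Proof.
move=> oU BU C2 eig /andP[rho0 rhor].
have mB := @measurable_eball R n 0 1.
have intw : (lebesgue_rV n).-integrable (eball 0 1)
    (EFin \o (fun z : 'rV[R]_n => (1 - sqn z) ^+ m)).
  apply: (@continuous_ball_integrable _ _ setT) => //; first exact: openT.
  by move=> z _; exact: continuous_weight.
(* At radius 0 the formula is read off directly; [ball_line] asks for a segment of positive
   length. *)
have [rho_eq0|rhoN0] := eqVneq rho 0.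
  rewrite rho_eq0 set_itv1 Rintegral_set1 mulr0 subr0 /ball_mean /ball_moment.
  rewrite mulrC -RintegralZl//; apply: eq_Rintegral => z _.
  by rewrite scale0r addr0.
have {}rho0 : 0 < rho by rewrite lt_def rhoN0.
have rho_r : 0 <= rho <= r by rewrite ltW.
(* The weighted derivative of [phi] along [z]. It is bounded by the sum of the bounds on the partial
   derivatives, because [|z_i| <= 1]. *)
pose S (p : R * 'rV[R]_n) : R :=
  (\sum_(i < n) p.2 ord0 i * partial i phi (x + p.1 *: p.2)) * (1 - sqn p.2) ^+ m.
have inx t z : t \in `[0, rho] -> eball 0 1 z -> eball x r (x + t *: z).
  rewrite in_itv/= => /andP[t0 t1]; apply: eball_affine.
  by rewrite t0 (le_trans t1).
have mS : measurable_fun (`[0, rho]%classic `*` eball 0 1) S.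
  apply: measurable_funM; last first.
    by apply: measurable_funTS; apply: (measurableT_comp (measurable_weight m)).
  apply: measurable_sum => i; apply: measurable_funM.
    by apply: measurable_funTS; apply: (measurableT_comp (measurable_coord i)).
  apply: measurable_cone rhor _.
  apply: (continuous_measurable_rV oU) => //; first exact: measurable_eball.
  by move=> y Uy; have [_ /(_ i)[]] := C2 _ Uy.
have /choice[M MP] : forall i : 'I_n, exists M, forall y, eball x r y -> `|partial i phi y| <= M.
  move=> i; apply: (eball_bounded oU BU) => y Uy.
  by have [_ /(_ i)[]] := C2 _ Uy.
have SM t z : t \in `[0, rho] -> eball 0 1 z -> `|S (t, z)| <= \sum_i M i.
  move=> tr Bz; rewrite /S/= normrM.
  rewrite -[leRHS]mulr1 ler_pM ?normr_ge0//; last exact: weight_bound.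
  apply: le_trans (ler_norm_sum _ _ _) _; apply: ler_sum => i _.
  rewrite normrM -[leRHS]mul1r ler_pM ?normr_ge0//; last exact/MP/inx.
  by have := eball_coord i Bz; rewrite mxE sub0r normrN.
have oV := @open_affine R n x rho _ oU.
have BV : eball 0 1 `<=` [set z | U (x + rho *: z)].
  by move=> z Bz; apply/BU/eball_affine.
have int3 : (lebesgue_rV n).-integrable (eball 0 1) (EFin \o
    (fun z : 'rV[R]_n => phi (x + rho *: z) * (1 - sqn z) ^+ m)).
  apply: (continuous_ball_integrable oV BV) => z Vz.
  apply: continuousM; last exact: continuous_weight.
  apply: (continuous_comp (@continuous_affine _ _ x rho z)).
  by have [] := C2 _ Vz.
have fin0r : (lebesgue_measure `[0%R, rho]%classic < +oo)%E.
  by rewrite /= lebesgue_measure_itv/= lte_fin rho0 -EFinB ltry.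
have m0r : measurable `[0, rho]%classic by exact: measurable_itv.
have [iS swapS] := bounded_Fubini (m1 := @lebesgue_measure R)
  (m2 := lebesgue_rV n) m0r mB fin0r (eball_fin 0 1) mS SM.
have SE t : t \in `[0, rho] -> \int[lebesgue_rV n]_(z in eball 0 1) S (t, z) =
    - (lambda / (2 * m.+1%:R)) * (t * ball_mean phi x m.+1 t).
  rewrite in_itv/= => /andP[t0 t1]; apply: (ball_mean_radial m oU BU C2 eig).
  by rewrite t0 (le_trans t1).
have -> : ball_mean phi x m rho = ball_moment n m * phi x +
    \int[lebesgue_measure]_(t in `[0, rho]) (\int[lebesgue_rV n]_(z in eball 0 1) S (t, z)).
  rewrite swapS /ball_mean /ball_moment -RintegralZr//.
  rewrite [X in _ + X](_ : _ = \int[lebesgue_rV n]_(z in eball 0 1)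
     (phi (x + rho *: z) * (1 - sqn z) ^+ m - (1 - sqn z) ^+ m * phi x)).
    rewrite RintegralB// ?subrKC//.
    rewrite (_ : _ \o _ = (fun z => (((1 - sqn z) ^+ m)%:E * (phi x)%:E)%E)).
      exact: integrableZr.
    by apply/funext => z; rewrite /= EFinM.
  apply: eq_Rintegral => z /set_mem Bz.
  have rr : 0 < rho <= r by rewrite rho0.
  have [iz zE] := ball_line oU BU C2 rr Bz.
  by rewrite /S/= RintegralZr// zE; ring.
congr (_ + _); rewrite -mulNr -RintegralZl//; last first.
  apply: (ball_mean_mul_integrable _ oU) => [y xy|y Uy].
    by apply: BU; rewrite /eball/=; apply: le_trans rhor.
  by have [] := C2 _ Uy.
by apply: eq_Rintegral => t /set_mem /=; exact: SE.
Qed.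

End ball_mean_step.

(** * Iteration of the integral identity *)

Section mean_series.
Context {R : realType}.

Lemma Rintegral_exprn (t : R) k : 0 <= t ->
  \int[lebesgue_measure]_(s in `[0, t]) s ^+ k = t ^+ k.+1 / k.+1%:R.
Proof.
move=> t0; have [->|tN0] := eqVneq t 0.
  by rewrite set_itv1 Rintegral_set1 expr0n/= mul0r.
have {tN0}t0 : 0 < t by rewrite lt_def tN0.
pose F : R -> R := (k.+1%:R)^-1 \*: (id ^+ k.+1).
have FE s : F s = s ^+ k.+1 / k.+1%:R by rewrite /F/= fctE/= /GRing.scale/= mulrC.
have dF (s : R) : is_derive s 1 F (s ^+ k).
  apply: is_derive_eq; rewrite /GRing.scale/= mulr1 mulrA mulVf ?pnatr_eq0// mul1r.
  by [].
have cF : continuous F.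
  move=> s; apply: differentiable_continuous; apply/derivable1_diffP.
  by have [] := dF s.
rewrite /Rintegral (@continuous_FTC2 _ _ F)//.
- by rewrite /= !FE expr0n/= mul0r subr0.
- by apply: continuous_subspaceT => s; exact: exprn_continuous.
- split=> [s _||]; first by have [] := dF s.
  + by apply: cvg_at_right_filter; exact: cF.
  + by apply: cvg_at_left_filter; exact: cF.
- by move=> s _; rewrite derive1E; have [] := dF s.
Qed.

Lemma integrable_exprn (t : R) k :
  lebesgue_measure.-integrable `[0, t] (EFin \o (fun s : R => s ^+ k)).
Proof.
apply: continuous_compact_integrable; first exact: segment_compact.
by apply: continuous_subspaceT => s; exact: exprn_continuous.
Qed.

(* The coefficient of [rho^(2k)] obtained by iterating ball_mean_step [k] times. *)
Definition mean_coef n (lambda : R) (m k : nat) : R :=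
  (- (lambda / 4)) ^+ k * ball_moment n (m + k) * m`!%:R / ((m + k)`!%:R * k`!%:R).

(** One iteration seen on coefficients: the factor [1 / (2 (k+1))] comes from integrating
    [t * t^(2k)]. *)
Lemma mean_coefS n (lambda : R) m k :
  mean_coef n lambda m k.+1 =
  - (lambda / (2 * m.+1%:R)) * (mean_coef n lambda m.+1 k / (2 * k.+1%:R)).
Proof.
rewrite /mean_coef addSnnS (factS m) (factS k) !natrM exprS.
have f0 (j : nat) : j`!%:R != 0 :> R by rewrite pnatr_eq0 -lt0n fact_gt0.
have s0 (j : nat) : j.+1%:R != 0 :> R by rewrite pnatr_eq0.
by field; rewrite !f0 !nat1r !s0.
Qed.

(** Induction on [N] for all [m] and [rho] at once, since the estimate at level [m] uses the one at
    level [m+1] over the whole segment [[0, rho]]. A step multiplies by [|lambda| / (2 (m+1))] and,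
    after integrating [t^(2N+1)], by [1 / (2 (N+1))]; this accounts for the [4] and for both
    factorials. *)
Lemma ball_mean_remainder n (U : set 'rV[R]_n) (phi : 'rV[R]_n -> R) (lambda r : R)
    (x : 'rV[R]_n) :
  open U -> eball x r `<=` U -> C2_on U phi ->
  (forall y, U y -> - laplacian phi y = lambda * phi y) ->
  exists K, forall N m rho, 0 <= rho <= r ->
   `|ball_mean phi x m rho - \sum_(0 <= k < N) phi x * mean_coef n lambda m k * rho ^+ (2 * k)|
   <= K * (`|lambda| / 4) ^+ N * m`!%:R / ((m + N)`!%:R * N`!%:R) * rho ^+ (2 * N).
Proof.
move=> oU BU C2 eig.
have cphi y : U y -> {for y, continuous phi} by move=> /C2[].
have [K bK iK] := ball_mean_integrable oU BU cphi.
have f0 (j : nat) : j`!%:R != 0 :> R by rewrite pnatr_eq0 -lt0n fact_gt0.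
have s0 (j : nat) : j.+1%:R != 0 :> R by rewrite pnatr_eq0.
exists K; elim=> [|N IHN] m rho /andP[rho0 rhor].
  rewrite big_geq// subr0 addn0 fact0 mulr1 expr0 !mulr1 mulfK//.
  by apply: bK; rewrite in_itv/= rho0.
have rho_r : 0 <= rho <= r by rewrite rho0.
have iG : lebesgue_measure.-integrable `[0, rho]
    (EFin \o (fun t => t * ball_mean phi x m.+1 t)).
  apply: (ball_mean_mul_integrable _ oU) => // y xy.
  by apply: BU; rewrite /eball/=; apply: le_trans rhor.
have iP k : lebesgue_measure.-integrable `[0, rho]
    (EFin \o (fun t : R => phi x * mean_coef n lambda m.+1 k * t ^+ (2 * k).+1)).
  rewrite (_ : _ \o _ = (fun t => (phi x * mean_coef n lambda m.+1 k)%:E *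
     (t ^+ (2 * k).+1)%:E)%E)//; exact/integrableZl/integrable_exprn.
have iS : lebesgue_measure.-integrable `[0, rho] (EFin \o (fun t : R =>
    \sum_(0 <= k < N) phi x * mean_coef n lambda m.+1 k * t ^+ (2 * k).+1)).
  by apply: integrable_sum_seq => [|k]; [exact: measurable_itv|exact: iP].
(* [t] times the remainder of order [N] at level [m+1]; its integral is, up to the constant, the
   remainder of order [N+1] at level [m]. *)
pose D t := t * ball_mean phi x m.+1 t -
  \sum_(0 <= k < N) phi x * mean_coef n lambda m.+1 k * t ^+ (2 * k).+1.
have E : ball_mean phi x m rho -
    \sum_(0 <= k < N.+1) phi x * mean_coef n lambda m k * rho ^+ (2 * k) =
    - (lambda / (2 * m.+1%:R)) * \int[lebesgue_measure]_(t in `[0, rho]) D t.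
  rewrite (ball_mean_step m oU BU C2 eig rho_r) RintegralB//.
  rewrite Rintegral_sum// big_nat_recl//= muln0 expr0 mulr1.
  have -> : mean_coef n lambda m 0 = ball_moment n m.
    by rewrite /mean_coef expr0 addn0 fact0; field.
  rewrite [X in _ - (_ + X)](_ : _ = - (lambda / (2 * m.+1%:R)) *
    \sum_(0 <= k < N) \int[lebesgue_measure]_(t in `[0, rho])
      (phi x * mean_coef n lambda m.+1 k * t ^+ (2 * k).+1)); last first.
    rewrite mulr_sumr; apply: eq_bigr => k _.
    have -> : \int[lebesgue_measure]_(t in `[0, rho])
       (phi x * mean_coef n lambda m.+1 k * t ^+ (2 * k).+1) =
       phi x * mean_coef n lambda m.+1 k * (rho ^+ (2 * k).+2 / (2 * k).+2%:R).
      by rewrite RintegralZl ?Rintegral_exprn//; exact: integrable_exprn.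
    rewrite mean_coefS mulnS -[(2 * k).+2]/(2 + 2 * k)%N -mulnS natrM.
    by field; rewrite !nat1r !s0.
  by ring.
have iD : lebesgue_measure.-integrable `[0, rho] (EFin \o D).
  by apply: (integrableB _ iG iS); exact: measurable_itv.
pose C := K * (`|lambda| / 4) ^+ N * m.+1`!%:R / ((m.+1 + N)`!%:R * N`!%:R).
have DC : `|\int[lebesgue_measure]_(t in `[0, rho]) D t| <=
    C * (rho ^+ (2 * N).+2 / (2 * N).+2%:R).
  apply: le_trans (le_normr_Rintegral _ _) _ => //.
  rewrite -Rintegral_exprn// -RintegralZl//; last exact: integrable_exprn.
  apply: le_Rintegral => //; first exact: integrable_norm.
    rewrite (_ : _ \o _ = (fun t => C%:E * (t ^+ (2 * N).+1)%:E)%E)//.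
    exact/integrableZl/integrable_exprn.
  move=> t; rewrite /= in_itv/= => /andP[t0 t1].
  have -> : D t = t * (ball_mean phi x m.+1 t -
     \sum_(0 <= k < N) phi x * mean_coef n lambda m.+1 k * t ^+ (2 * k)).
    rewrite mulrBr mulr_sumr; congr (_ - _); apply: eq_bigr => k _.
    by rewrite exprS; ring.
  rewrite normrM ger0_norm// exprS [leRHS]mulrCA ler_wpM2l//.
  by apply: IHN; rewrite t0 (le_trans t1).
rewrite E normrM normrN normf_div [`|2 * _|]ger0_norm ?mulr_ge0//.
apply: le_trans (ler_wpM2l _ DC) _; first by rewrite divr_ge0 ?mulr_ge0.
rewrite /C addSnnS [m.+1`!]factS [N.+1`!]factS !natrM (exprS (_ / 4)).
rewrite -[(2 * N).+2]/(2 + 2 * N)%N -mulnS natrM.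
rewrite le_eqVlt; apply/orP; left; apply/eqP. field; rewrite ?f0 ?nat1r ?s0 ?f0 /=.
by [].
Qed.

End mean_series.

(** * Odd power series *)

Section power_series.
Context {R : realType}.

Lemma series_exp_coeff_le (y : R) N : 0 <= y -> series (exp_coeff y) N <= expR y.
Proof.
move=> y0; apply: nondecreasing_cvgn_le; last exact: is_cvg_series_exp_coeff.
by apply: nondecreasing_series => k _ _; exact: exp_coeff_ge0.
Qed.

(** Odd powers suit both sides of the theorem: they occur in [rho G_0(rho)] and in the Bessel
    integrand [s^((4-n)/2) J_((n-2)/2)(s)]. The hypothesis on [d] makes the exponential series of
    [a t^2] a majorant, uniformly in [s <= t]. *)
Lemma odd_series_bound (d : nat -> R) (C a s t : R) : 0 <= s <= t -> 0 <= a ->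
  (forall k, `|d k| <= C * a ^+ k / k`!%:R) ->
  forall k, `|d k * s ^+ (2 * k).+1| <= (C * t) * exp_coeff (a * t ^+ 2) k.
Proof.
move=> /andP[s0 st] a0 dC k; rewrite normrM [`|s ^+ _|]ger0_norm ?exprn_ge0//.
apply: (@le_trans _ _ (C * a ^+ k / k`!%:R * t ^+ (2 * k).+1)).
  by rewrite ler_pM ?exprn_ge0// lerXn2r// nnegrE (le_trans s0).
by rewrite /exp_coeff/= exprMn -exprM exprS le_eqVlt; apply/orP; left; apply/eqP; ring.
Qed.

Lemma cvg_odd_series (d : nat -> R) (C a s : R) : 0 <= s -> 0 <= a ->
  (forall k, `|d k| <= C * a ^+ k / k`!%:R) ->
  cvgn (series (fun k => d k * s ^+ (2 * k).+1)).
Proof.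
move=> s0 a0 dC; apply: normed_cvg.
have ss : 0 <= s <= s by rewrite s0 lexx.
have C0 : 0 <= C.
  by have := dC 0%N; rewrite expr0 fact0 mulr1 divr1; apply: le_trans.
apply: (@series_le_cvg _ _ (fun k => (C * s) * exp_coeff (a * s ^+ 2) k)) => //.
- by move=> k; exact: normr_ge0.
- move=> k; apply: mulr_ge0; first exact: mulr_ge0.
  by apply: exp_coeff_ge0; rewrite mulr_ge0 ?exprn_ge0.
- by move=> k; exact: odd_series_bound.
- exact/is_cvg_seriesZ/is_cvg_series_exp_coeff.
Qed.

(** Dominated convergence: all partial sums are bounded on [[0, t]] by the constant
    [C t exp(a t^2)]. Measurability of [f] comes from its being a pointwise limit. *)
Lemma integral_odd_series (d : nat -> R) (C a t : R) (f : R -> R) :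
  0 <= t -> 0 <= a -> (forall k, `|d k| <= C * a ^+ k / k`!%:R) ->
  (forall s, 0 <= s <= t -> series (fun k => d k * s ^+ (2 * k).+1) @ \oo --> f s) ->
  series (fun k => d k * (t ^+ (2 * k).+2 / (2 * k).+2%:R)) @ \oo -->
    \int[lebesgue_measure]_(s in `[0, t]) f s.
Proof.
move=> t0 a0 dC df.
have C0 : 0 <= C.
  by have := dC 0%N; rewrite expr0 fact0 mulr1 divr1; apply: le_trans.
pose p N (s : R) := series (fun k => d k * s ^+ (2 * k).+1) N.
have ip N : lebesgue_measure.-integrable `[0, t] (EFin \o p N).
  apply: integrable_sum_seq => [|k]; first exact: measurable_itv.
  rewrite (_ : _ \o _ = (fun s => (d k)%:E * (s ^+ (2 * k).+1)%:E)%E)//.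
  exact/integrableZl/integrable_exprn.
have intp N : \int[lebesgue_measure]_(s in `[0, t]) p N s =
    series (fun k => d k * (t ^+ (2 * k).+2 / (2 * k).+2%:R)) N.
  rewrite /p/series/= Rintegral_sum => [|//|k]; last first.
    rewrite (_ : _ \o _ = (fun s => (d k)%:E * (s ^+ (2 * k).+1)%:E)%E)//.
    exact/integrableZl/integrable_exprn.
  apply: eq_bigr => k _.
  by rewrite RintegralZl ?Rintegral_exprn//; exact: integrable_exprn.
pose M := C * t * expR (a * t ^+ 2).
have pM N s : `[0, t]%classic s -> `|p N s| <= M.
  rewrite /= in_itv/= => st; apply: le_trans (ler_norm_sum _ _ _) _.
  apply: (@le_trans _ _ (C * t * series (exp_coeff (a * t ^+ 2)) N)).
    rewrite /series/= mulr_sumr; apply: ler_sum => k _.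
    exact: odd_series_bound.
  rewrite ler_wpM2l ?mulr_ge0//; apply: series_exp_coeff_le.
  by rewrite mulr_ge0// exprn_ge0.
have mp N := measurable_int _ (ip N).
have mf : measurable_fun `[0, t] f.
  apply: (@measurable_fun_cvg _ _ _ _ p) => //.
  by move=> N; apply/measurable_EFinP; exact: mp.
have m0t : measurable `[0, t]%classic by exact: measurable_itv.
have mf' : measurable_fun `[0, t] (EFin \o f) by exact/measurable_EFinP.
have cvp : {ae @lebesgue_measure R, forall s, `[0, t]%classic s ->
    (EFin \o p N) s @[N --> \oo] --> (EFin \o f) s}.
  apply: aeW => s /=; rewrite in_itv/= => /df dfs.
  by apply: cvg_EFin => //; exact: nearW.
have iM : lebesgue_measure.-integrable `[0, t] (EFin \o (fun=> M)).
  apply: (@bounded_integrable _ _ _ _ _ (fun=> M) `|M|) => //.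
  by rewrite /= lebesgue_measure_itv/=; case: ifP => _; rewrite ?ltry// -EFinB ltry.
have domp : {ae @lebesgue_measure R, forall s N, `[0, t]%classic s ->
    (`|(EFin \o p N) s| <= (EFin \o (fun=> M)) s)%E}.
  by apply: aeW => s /= N st; rewrite lee_fin; exact: pM.
have [if_ _ cv] := @dominated_convergence _ _ R (@lebesgue_measure R) _ m0t
  _ _ _ mp mf' cvp iM domp.
have -> : series (fun k => d k * (t ^+ (2 * k).+2 / (2 * k).+2%:R)) =
    (fun N => \int[lebesgue_measure]_(s in `[0, t]) p N s).
  by apply/funext => N; rewrite intp.
by apply: fine_cvg; rewrite /Rintegral fineK//; apply: integrable_fin_num.
Qed.

(** At [m = 0] the remainder is at most [K y^N / (N!)^2] with [y = |lambda| rho^2 / 4]. Dropping one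
    factorial leaves a term of the exponential series, which tends to 0. *)
Lemma cvg_ball_mean n (U : set 'rV[R]_n) (phi : 'rV[R]_n -> R) (lambda r rho : R)
    (x : 'rV[R]_n) :
  open U -> eball x r `<=` U -> C2_on U phi ->
  (forall y, U y -> - laplacian phi y = lambda * phi y) ->
  0 <= rho <= r ->
  series (fun k => phi x * mean_coef n lambda 0 k * rho ^+ (2 * k)) @ \oo -->
    ball_mean phi x 0 rho.
Proof.
move=> oU BU C2 eig rr; have /andP[r0 _] := rr.
have [K KP] := ball_mean_remainder oU BU C2 eig.
pose y := `|lambda| / 4 * rho ^+ 2.
have y0 : 0 <= y by rewrite mulr_ge0 ?exprn_ge0.
apply/cvgrPdist_le => e e0.
(* The sign of [K] is not recorded, hence the absolute value. *)
have : `|K| * exp_coeff y N @[N --> \oo] --> `|K| * 0.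
  by apply: cvgMr; exact/cvg_series_cvg_0/is_cvg_series_exp_coeff.
rewrite mulr0 => /cvgrPdist_le/(_ e e0); apply: filterS => N.
rewrite sub0r normrN; apply: le_trans; apply: (le_trans (KP N 0%N rho rr)).
rewrite add0n fact0 mulr1 [leRHS]ger0_norm ?mulr_ge0 ?exp_coeff_ge0//.
apply: (@le_trans _ _ (`|K| * ((`|lambda| / 4) ^+ N / (N`!%:R * N`!%:R) * rho ^+ (2 * N)))).
  rewrite -!mulrA ler_wpM2r ?ler_norm// ?mulr_ge0 ?exprn_ge0//.
rewrite ler_wpM2l//.
have -> : exp_coeff y N = (`|lambda| / 4) ^+ N * rho ^+ (2 * N) / N`!%:R.
  by rewrite /exp_coeff/= /y exprMn exprM.
rewrite invfM; set q := (_ * _ / _ in leRHS).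
rewrite [leLHS](_ : _ = q * N`!%:R^-1); last by rewrite /q; ring.
rewrite ler_piMr//; first by rewrite /q !mulr_ge0 ?exprn_ge0.
by rewrite invf_le1 ?ltr0n ?fact_gt0// ler1n fact_gt0.
by rewrite exprn_ge0.
Qed.

End power_series.

(** * Moments of the ball and the Gamma function *)

Section moments.
Context {R : realType}.

Lemma ball_moment0 n : ball_moment n 0 = omega n :> R.
Proof.
rewrite /ball_moment /omega; under eq_Rintegral do rewrite expr0.
by rewrite Rintegral_cst ?mul1r//; exact: measurable_eball.
Qed.

Lemma is_derive_coord n (i : 'I_n) (z : 'rV[R]_n) :
  is_derive z (delta_mx 0 i : 'rV[R]_n) (fun z : 'rV[R]_n => z ord0 i) 1.
Proof.
have -> : z = z + 0 *: delta_mx 0 i by rewrite scale0r addr0.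
apply/is_derive_line.
have -> : (fun u : R => (z + u *: (delta_mx 0 i : 'rV[R]_n)) ord0 i) =
    cst (z ord0 i) + id.
  by apply/funext => u; rewrite !mxE !eqxx mulr1.
by apply: is_derive_eq; rewrite add0r.
Qed.

(** The difference [c_m - c_(m+1)] is the integral of [|z|^2 (1 - |z|^2)^m]. By [ball_by_parts] with
    [g = z_i], each of its [n] summands equals [c_(m+1) / (2 (m+1))]. *)
Lemma ball_moment_rec n m : ball_moment n m =
  ball_moment n m.+1 * (1 + n%:R / (2 * m.+1%:R)) :> R.
Proof.
have mB := @measurable_eball R n 0 1.
have iB (h : 'rV[R]_n -> R) : continuous h ->
    (lebesgue_rV n).-integrable (eball 0 1) (EFin \o h).
  move=> ch; apply: (@continuous_ball_integrable _ _ setT) => //; first exact: openT.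
  by move=> z _; exact: ch.
have iw k : (lebesgue_rV n).-integrable (eball 0 1)
    (EFin \o (fun z : 'rV[R]_n => (1 - sqn z) ^+ k)).
  by apply: iB; exact: continuous_weight.
have izz (i : 'I_n) : (lebesgue_rV n).-integrable (eball 0 1)
    (EFin \o (fun z : 'rV[R]_n => z ord0 i ^+ 2 * (1 - sqn z) ^+ m)).
  apply: iB => z; apply: (@continuousM _ _ (fun z : 'rV[R]_n => z ord0 i ^+ 2)
    (fun z : 'rV[R]_n => (1 - sqn z) ^+ m)); last exact: continuous_weight.
  apply: (@continuous_comp _ R R (fun v : 'rV[R]_n => v ord0 i) (fun a : R => a ^+ 2)).
    exact: coord_continuous.
  exact: exprn_continuous.
have m2 : 2 * m.+1%:R != 0 :> R by rewrite mulf_neq0// pnatr_eq0.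
have E (i : 'I_n) : \int[lebesgue_rV n]_(z in eball (0 : 'rV[R]_n) 1)
    (z ord0 i ^+ 2 * (1 - sqn z) ^+ m) = ball_moment n m.+1 / (2 * m.+1%:R).
  have H := @ball_by_parts R n i (fun z => z ord0 i) (fun=> 1) setT m openT
    (fun _ _ => I) (fun z _ => is_derive_coord i z)
    (fun z _ => @coord_continuous _ _ _ _ _ z) (fun z _ => @cst_continuous _ _ _ z).
  apply: (mulfI m2); rewrite -RintegralZl// [RHS]mulrC divfK//.
  transitivity (\int[lebesgue_rV n]_(z in eball (0 : 'rV[R]_n) 1)
     (2 * m.+1%:R * z ord0 i * z ord0 i * (1 - sqn z) ^+ m)).
    by apply: eq_Rintegral => z _; ring.
  by rewrite H; apply: eq_Rintegral => z _; rewrite mul1r.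
have D : ball_moment n m - ball_moment n m.+1 = \sum_(i < n)
   \int[lebesgue_rV n]_(z in eball (0 : 'rV[R]_n) 1) (z ord0 i ^+ 2 * (1 - sqn z) ^+ m) :> R.
  rewrite -Rintegral_sum// /ball_moment -RintegralB//.
  by apply: eq_Rintegral => z _; rewrite -mulr_suml -/(sqn z) exprS; ring.
move: D; under eq_bigr do rewrite E.
rewrite sumr_const card_ord -mulr_natl => /eqP; rewrite subr_eq => /eqP ->.
by ring.
Qed.

End moments.

(** * Convergence, positivity and recurrence of Euler's integral *)

Section gamma.
Context {R : realType}.

Definition Gamma_dens (a t : R) : R := t `^ (a - 1) * expR (- t).

Lemma powR_le_expR (b : R) : 0 <= b ->
  exists2 C, 0 <= C & forall t, 0 <= t -> t `^ b <= C * expR (t / 2).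
Proof.
(* With [k > b], the term of index [k] in the exponential series of [t/2] dominates [t^b] for
   [t > 1]; the summand 1 in the constant covers [t <= 1]. *)
move=> b0; pose k := (Num.trunc b).+1.
exists (1 + 2 ^+ k * k`!%:R) => [|t t0].
  by rewrite addr_ge0// mulr_ge0// exprn_ge0.
have t2 : 0 <= t / 2 by rewrite divr_ge0.
have e1 : 1 <= expR (t / 2) by apply: le_trans (expR_ge1Dx _); rewrite lerDl.
have tk : t ^+ k <= 2 ^+ k * k`!%:R * expR (t / 2).
  apply: (@le_trans _ _ (2 ^+ k * k`!%:R * exp_coeff (t / 2) k)).
    rewrite /exp_coeff/= expr_div_n le_eqVlt; apply/orP; left; apply/eqP.
    by field; rewrite pnatr_eq0 -lt0n fact_gt0 expf_neq0.
  rewrite ler_wpM2l ?mulr_ge0 ?exprn_ge0//.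
  apply: le_trans (series_exp_coeff_le k.+1 t2).
  rewrite /series/= big_nat_recr//= lerDr sumr_ge0// => j _.
  exact: exp_coeff_ge0.
rewrite mulrDl mul1r; have [t1|t1] := leP t 1.
  apply: (@le_trans _ _ 1).
    have <- : 1 `^ b = 1 :> R by rewrite powR1.
    by rewrite ge0_ler_powR ?nnegrE.
  by rewrite (le_trans e1)// lerDl !mulr_ge0 ?exprn_ge0 ?expR_ge0.
apply: (@le_trans _ _ (t ^+ k)).
  rewrite -powR_mulrn// ler_powR ?ltW//; exact: truncnS_gt.
by apply: le_trans tk _; rewrite lerDr expR_ge0.
Qed.

Lemma Gamma_dens_ge0 a t : 0 <= Gamma_dens a t.
Proof. by rewrite mulr_ge0 ?powR_ge0 ?expR_ge0. Qed.

(** Half of the exponential decay absorbs the power, and the other half stays as an integrable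
    majorant. *)
Lemma Gamma_dens_le (a : R) : 1 <= a ->
  exists2 C, 0 <= C & forall t, 0 <= t -> Gamma_dens a t <= C * expR (- (t / 2)).
Proof.
move=> a1; have [|C C0 CP] := @powR_le_expR (a - 1); first by rewrite subr_ge0.
exists C => // t t0; rewrite /Gamma_dens.
apply: (@le_trans _ _ (C * expR (t / 2) * expR (- t))).
  by rewrite ler_wpM2r ?expR_ge0 ?CP.
by rewrite -mulrA -expRD le_eqVlt; apply/orP; left; apply/eqP; congr (_ * expR _); field.
Qed.

Lemma measurable_Gamma_dens (a : R) : measurable_fun setT (Gamma_dens a).
Proof.
apply: measurable_funM; first exact: measurable_powR.
apply: measurableT_comp; first exact: measurable_expR.
exact: measurable_funN.
Qed.

Lemma integrable_Gamma_dens (a : R) : 1 <= a ->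
  lebesgue_measure.-integrable `[0, +oo[ (EFin \o Gamma_dens a).
Proof.
move=> a1; have [C C0 CP] := Gamma_dens_le a1.
have m0 : measurable `[(0 : R), +oo[%classic by exact: measurable_itv.
(* The majorant [C exp(-t/2)] is [2 C] times the exponential density of rate [1/2]. *)
have ie : lebesgue_measure.-integrable `[0, +oo[ (EFin \o
    (fun t : R => 2 * C * exponential_pdf 2^-1 t)).
  rewrite (_ : _ \o _ = (fun t => (2 * C)%:E * (exponential_pdf 2^-1 t)%:E)%E)//.
  apply: integrableZl => //; apply: (@integrableS _ _ _ _ setT) => //.
  by apply: integrable_exponential_pdf.
apply: le_integrable ie => //.
  by apply/measurable_EFinP; apply: measurable_funTS; exact: measurable_Gamma_dens.
move=> t; rewrite /= in_itv/= andbT => t0; rewrite lee_fin.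
rewrite ger0_norm ?Gamma_dens_ge0// (le_trans (CP t t0))//.
rewrite exponential_pdfE// ger0_norm ?mulr_ge0 ?expR_ge0// ?invr_ge0//.
rewrite le_eqVlt; apply/orP; left; apply/eqP.
by rewrite mulNr [_^-1 * t]mulrC; field.
Qed.

End gamma.

Section gamma_recurrence.
Context {R : realType}.

Lemma GammaE (a : R) : 1 <= a ->
  Gamma a = \int[lebesgue_measure]_(t in `[0, +oo[) Gamma_dens a t.
Proof.
move=> a1; rewrite /Gamma Rintegral_itv_obnd_cbnd//.
apply: (integrableS _ _ _ (integrable_Gamma_dens a1)).
- exact: measurable_itv.
- exact: measurable_itv.
- by move=> t; rewrite /= !in_itv/= !andbT; exact: ltW.
Qed.

(** On [[1, 2]] the integrand is at least [exp(-2)], as [t^(a-1) >= 1] there. *)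
Lemma Gamma_gt0 (a : R) : 1 <= a -> 0 < Gamma a.
Proof.
move=> a1; rewrite GammaE//.
have i0 := integrable_Gamma_dens a1.
have i12 : lebesgue_measure.-integrable `[1, 2] (EFin \o Gamma_dens a).
  apply: (integrableS _ _ _ i0).
  - exact: measurable_itv.
  - exact: measurable_itv.
  - by move=> t; rewrite /= !in_itv/= andbT => /andP[t1 _]; exact: le_trans t1.
apply: (@lt_le_trans _ _ (\int[lebesgue_measure]_(t in `[(1 : R), 2]) expR (- 2))).
  rewrite Rintegral_cst; last exact: measurable_itv.
  by rewrite /= lebesgue_measure_itv/= lte_fin ltr1n/= mulr_gt0 ?expR_gt0//.
apply: (@le_trans _ _ (\int[lebesgue_measure]_(t in `[(1 : R), 2]) Gamma_dens a t)).
  apply: le_Rintegral => //.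
    apply: continuous_compact_integrable; first exact: segment_compact.
    by apply: continuous_subspaceT => t; exact: cvg_cst.
  move=> t; rewrite /= in_itv/= => /andP[t1 t2]; rewrite /Gamma_dens.
  rewrite -[leLHS]mul1r ler_pM ?expR_ge0//.
    apply: (@le_trans _ _ (t `^ 0)); first by rewrite powRr0.
    by rewrite ler_powR// subr_ge0.
  by rewrite ler_expR lerN2.
rewrite /Rintegral fine_le//.
- by apply: integrable_fin_num => //; exact: measurable_itv.
- by apply: integrable_fin_num => //; exact: measurable_itv.
apply: ge0_subset_integral => //.
- exact: measurable_int i0.
- by move=> t _; rewrite lee_fin Gamma_dens_ge0.
- by move=> t; rewrite /= !in_itv/= andbT => /andP[t1 _]; exact: le_trans t1.
Qed.

Lemma continuous_Gamma_dens (a t : R) : 0 < t -> {for t, continuous (Gamma_dens a)}.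
Proof.
move=> t0; apply: continuousM.
  apply: differentiable_continuous; apply/derivable1_diffP.
  by have [] := is_derive1_powR (a - 1) t0.
by apply: continuous_comp; [exact: opp_continuous|exact: continuous_expR].
Qed.

Lemma Gamma_dens_at0 (a : R) : 1 < a -> Gamma_dens a t @[t --> 0^'+] --> Gamma_dens a 0.
Proof.
move=> a1; rewrite {2}/Gamma_dens powR0 ?subr_eq0 ?gt_eqF// mul0r.
rewrite -[X in _ --> X](mul0r (expR (- 0))).
apply: cvgM; first by apply: powR_cvg0; rewrite subr_gt0.
apply: cvg_at_right_filter.
by apply: continuous_comp; [exact: opp_continuous|exact: continuous_expR].
Qed.

Lemma Gamma_dens_pinfty (a : R) : 1 <= a -> Gamma_dens a t @[t --> +oo] --> 0.
Proof.
move=> a1; have [C C0 CP] := Gamma_dens_le a1.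
have Ce : C * expR (- (t / 2)) @[t --> +oo] --> 0.
  rewrite -[X in _ --> X](mulr0 C); apply: cvgMr.
  apply: (@cvg_comp _ _ _ (fun t : R => t / 2) (fun t => expR (- t)) _ +oo);
    last exact: cvgr_expR.
  exact: gt0_cvgMly.
apply: (squeeze_cvgr _ _ Ce); last exact: cvg_cst.
near=> t; rewrite Gamma_dens_ge0 CP//.
Unshelve. all: by end_near. Qed.

(** [F(t) = t^a exp(-t)] vanishes at 0 and at infinity, and its derivative [h] is [a] times the
    integrand for [a] minus the integrand for [a + 1]; hence [h] has integral 0. With [1 < a] the
    function [h] is continuous up to 0. *)
Lemma GammaS (a : R) : 1 < a -> Gamma (a + 1) = a * Gamma a.
Proof.
move=> a1; have a1' := ltW a1.
have a0 : 0 < a by apply: lt_trans a1.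
have a11 : 1 < a + 1 by rewrite ltrDr.
(* [h = F'] changes sign only at [a], so FTC applies separately on [0, a] and [a, +oo[. *)
pose h t := a * Gamma_dens a t - Gamma_dens (a + 1) t.
pose F t := Gamma_dens (a + 1) t.
have ia := integrable_Gamma_dens a1'.
have ia1 := integrable_Gamma_dens (ltW a11).
have m0 : measurable `[(0 : R), +oo[%classic by exact: measurable_itv.
have iaa : lebesgue_measure.-integrable `[0, +oo[ (EFin \o (fun t => a * Gamma_dens a t)).
  by rewrite (_ : _ \o _ = (fun t => a%:E * (Gamma_dens a t)%:E)%E)//; exact: integrableZl.
have ih : lebesgue_measure.-integrable `[0, +oo[ (EFin \o h).
  by apply: (integrableB _ iaa ia1); exact: measurable_itv.
have dF (t : R) : 0 < t -> is_derive t 1 F (h t).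
  move=> t0.
  have -> : F = (fun u : R => u `^ a) * (fun u : R => expR (- u)).
    by apply/funext => u; rewrite /F /Gamma_dens addrK.
  have P := is_derive1_powR a t0.
  have N : is_derive t 1 (-%R : R -> R) (- 1).
    by have := @is_deriveN R R R id t 1 1 (is_derive_id _ _).
  have E : is_derive t 1 (fun u : R => expR (- u)) (expR (- t) * - 1).
    by apply: (@is_derive1_comp _ expR (-%R)).
  by apply: is_derive_eq; rewrite /h /Gamma_dens addrK /GRing.scale/=; ring.
have ch (t : R) : 0 < t -> {for t, continuous h}.
  move=> t0; apply: continuousB; last exact: continuous_Gamma_dens.
  by apply: continuousM; [exact: cst_continuous|exact: continuous_Gamma_dens].
have cF (t : R) : 0 < t -> {for t, continuous F} by move=> t0; exact: continuous_Gamma_dens.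
have h0 : h t @[t --> 0^'+] --> h 0.
  apply: cvgB; last exact: Gamma_dens_at0.
  by apply: cvgM; [exact: cvg_cst|exact: Gamma_dens_at0].
have F00 : F 0 = 0 by rewrite /F /Gamma_dens addrK powR0 ?mul0r// gt_eqF.
have int1 : \int[lebesgue_measure]_(t in `[0, a]) h t = F a.
  rewrite /Rintegral (@continuous_FTC2 _ _ F)//.
  - by rewrite /= F00 subr0.
  - apply/continuous_within_itvP => //; split => //.
    + by move=> t; rewrite in_itv/= => /andP[t0 _]; exact: ch.
    + by apply: cvg_at_left_filter; exact: ch.
  - split.
    + by move=> t; rewrite in_itv/= => /andP[t0 _]; have [] := dF t t0.
    + exact: Gamma_dens_at0.
    + by apply: cvg_at_left_filter; exact: cF.
  - by move=> t; rewrite in_itv/= derive1E => /andP[t0 _]; have [] := dF t t0.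
(* Beyond [a] the function [h] is nonpositive, so the fundamental theorem on the half-line is
   applied to [- h]. *)
have int2 : \int[lebesgue_measure]_(t in `[a, +oo[) (- h t) = F a.
  rewrite (@Rintegral_ge0_continuous_FTC2y _ _ (- F) a 0).
  - by rewrite sub0r fctE opprK.
  - move=> t ta; rewrite oppr_ge0 /h subr_le0 /Gamma_dens addrK mulrA ler_wpM2r ?expR_ge0//.
    have t0 : 0 < t by apply: lt_le_trans ta.
    apply: (@le_trans _ _ (t * t `^ (a - 1))); first by rewrite ler_wpM2r ?powR_ge0.
    by rewrite mulr_powRB1// ltW.
  - apply: (continuous_within_itvcyP a (fun t => - h t)).2; split.
      move=> t; rewrite in_itv/= andbT => ta; apply: continuousN; apply: ch.
      exact: lt_trans ta.
    by apply: cvgN; apply: cvg_at_right_filter; exact: ch.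
  - by rewrite -oppr0; apply: cvgN; exact: Gamma_dens_pinfty (ltW a11).
  - by move=> t ta; apply: derivableN; have [] := dF t (lt_trans a0 ta).
  - by apply: cvgN; apply: cvg_at_right_filter; exact: cF.
  - move=> t; rewrite in_itv/= andbT => ta; have := dF t (lt_trans a0 ta).
    by move=> [dt <-]; rewrite derive1E deriveN.
have iha : lebesgue_measure.-integrable `[a, +oo[ (EFin \o h).
  apply: (integrableS _ _ _ ih).
  - exact: measurable_itv.
  - exact: measurable_itv.
  - by move=> t; rewrite /= !in_itv/= !andbT; apply: le_trans; exact: ltW.
have iha' : lebesgue_measure.-integrable `]a, +oo[ (EFin \o h).
  apply: (integrableS _ _ _ iha).
  - exact: measurable_itv.
  - exact: measurable_itv.
  - by move=> t; rewrite /= !in_itv/= !andbT; exact: ltW.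
have H0 : \int[lebesgue_measure]_(t in `[0, +oo[) h t = 0.
  have := @Rintegral_itvB R h (BLeft 0) +oo%O a ih.
  rewrite !bnd_simp => /(_ (ltW a0) isT).
  rewrite Rintegral_itv_obnd_cbnd// int1.
  have -> : \int[lebesgue_measure]_(t in `[a, +oo[) h t = - F a.
    rewrite -int2; transitivity (- (-1 * \int[lebesgue_measure]_(t in `[a, +oo[) h t)).
      by rewrite mulN1r opprK.
    rewrite -RintegralZl//; congr (- _).
    by apply: eq_Rintegral => t _; rewrite mulN1r.
  by move=> /eqP; rewrite subr_eq addNr => /eqP.
have H1 : \int[lebesgue_measure]_(t in `[0, +oo[) h t = a * Gamma a - Gamma (a + 1).
  by rewrite RintegralB// RintegralZl// -!GammaE ?(ltW a11).
by apply/eqP; rewrite eq_sym -subr_eq0 -H1 H0.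
Qed.

End gamma_recurrence.

(** * The Newtonian kernel *)

Section layer_cake.
Context {R : realType}.

Lemma integral_inv_pow (p : nat) (s r : R) : 0 < s <= r ->
  lebesgue_measure.-integrable `[s, r]
    (EFin \o (fun rho : R => p%:R * rho `^ (- p.+1%:R))) /\
  (\int[lebesgue_measure]_(rho in `[s, r]) (p%:R * rho `^ (- p.+1%:R))%R%:E)%E =
  (s `^ (- p%:R) - r `^ (- p%:R))%:E.
Proof.
move=> /andP[s0 sr].
have cf : {within `[s, r], continuous (fun rho : R => p%:R * rho `^ (- p.+1%:R))}.
  apply: continuous_in_subspaceT => t /set_mem/=; rewrite in_itv/= => /andP[st _].
  have t0 : 0 < t by apply: lt_le_trans st.
  apply: cvgM; first exact: cvg_cst.
  suff : {for t, continuous (fun u : R => u `^ (- p.+1%:R))} by [].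
  apply: differentiable_continuous; apply/derivable1_diffP.
  by have [] := is_derive1_powR (- p.+1%:R) t0.
split; first by apply: continuous_compact_integrable => //; exact: segment_compact.
move: cf sr; rewrite le_eqVlt => cf /predU1P[<-|sr].
  by rewrite set_itv1 integral_set1 subrr.
pose F : R -> R := fun rho => - rho `^ (- p%:R).
have dF (t : R) : 0 < t -> is_derive t 1 F (p%:R * t `^ (- p.+1%:R)).
  move=> t0; have P := is_derive1_powR (- p%:R) t0.
  have -> : p%:R * t `^ (- p.+1%:R) = - (- p%:R * t `^ (- p%:R - 1)).
    by rewrite mulNr opprK -natr1 opprD.
  exact: is_deriveN.
have cF (t : R) : 0 < t -> {for t, continuous F}.
  move=> t0; apply: differentiable_continuous; apply/derivable1_diffP.
  by have [] := dF t t0.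
rewrite (@continuous_FTC2 _ _ F)//.
- by rewrite -EFinB /F opprK addrC.
- split=> [t||].
  + by rewrite in_itv/= => /andP[st _]; have [] := dF t (lt_trans s0 st).
  + by apply: cvg_at_right_filter; exact: cF.
  + by apply: cvg_at_left_filter; apply: cF; exact: lt_trans sr.
- move=> t; rewrite in_itv/= derive1E => /andP[st _].
  by have [] := dF t (lt_trans s0 st).
Qed.

(** The affine change of variables applied to the constant function 1. *)
Lemma lebesgue_eball n (x : 'rV[R]_n) (rho : R) : 0 < rho ->
  lebesgue_rV n (eball x rho) = (rho ^+ n * omega n)%:E.
Proof.
move=> rho0; have := @integral_eball_affine R n x rho 1 (cst 1) rho0 (measurable_cst _).
rewrite /= !integral_cst; [|exact: measurable_eball|exact: measurable_eball].
rewrite !mul1e => ->; last by move=> y _; rewrite normr1.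
by rewrite EFinM /omega fineK// ge0_fin_numE// eball_fin.
Qed.

Lemma set1_rV_box n (x : 'rV[R]_n) : [set x] = rV_box (fun i => [set x ord0 i]).
Proof.
by apply/seteqP; split => [y -> i//|y yx]; apply/rowP => i; exact: yx.
Qed.

Lemma measurable_rV_set1 n (x : 'rV[R]_n) : measurable [set x].
Proof.
by rewrite set1_rV_box; apply: measurable_rV_box => i; exact: measurable_set1.
Qed.

(** Positive dimension matters: in dimension 0 the measure is a Dirac mass at the only point. *)
Lemma lebesgue_rV_set1 n (x : 'rV[R]_n.+1) : lebesgue_rV n.+1 [set x] = 0%E.
Proof.
rewrite set1_rV_box.
transitivity (\prod_(i < n.+1) lebesgue_measure ([set x ord0 i] : set (measurableTypeR R)))%E.
  by apply: lebesgue_rV_box => i; exact: measurable_set1.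
by rewrite big_ord_recl/= lebesgue_measure_set1 mul0e.
Qed.

(** With [n = p + 2], Fubini is applied to [phi(y) p rho^(-(p+1))] on the region
    [|y - x| <= rho <= r]. Integrating [rho] first gives the kernel minus its value on the sphere;
    integrating [y] first gives [p rho^(-(p+1)) rho^n G_0(rho) = p rho G_0(rho)], in which the
    singularity has disappeared. The equality holds in the extended reals, so finiteness of the
    singular integral is part of it. *)
Lemma layer_cake p (U : set 'rV[R]_p.+2) (phi : 'rV[R]_p.+2 -> R) (r : R)
    (x : 'rV[R]_p.+2) :
  (0 < p)%N -> 0 < r ->
  open U -> eball x r `<=` U -> (forall y, U y -> {for y, continuous phi}) ->
  (\int[lebesgue_rV p.+2]_(y in eball x r) (phi y / enorm (y - x) ^+ p)%:E =
   (r ^+ 2 * ball_mean phi x 0 r + p%:R *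
    \int[lebesgue_measure]_(rho in `[0%R, r]) (rho * ball_mean phi x 0 rho))%:E)%E.
Proof.
move=> p0 r0 oU BU cphi.
have [M MP] := eball_bounded oU BU cphi.
have mB rho := @measurable_eball R p.+2 x rho.
have mphi : measurable_fun (eball x r) phi.
  by apply: (continuous_measurable_rV oU).
(* [phi] is controlled on the ball only; extended by zero it is measurable everywhere. *)
pose phi' : 'rV[R]_p.+2 -> R := phi \_ (eball x r).
have mphi' : measurable_fun setT phi' by apply/(measurable_restrictT _ (mB r)).
(* [s^-p = r^-p + \int_s^r p rho^-(p+1) drho] with [s = |y - x|]; it fails only at
   [y = x], where the integral diverges while [1 / 0 = 0]. *)
pose A : set ('rV[R]_p.+2 * R) := [set q | enorm (q.1 - x) <= q.2 /\ 0 < q.2 <= r].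
have msub : measurable_fun setT (fun y : 'rV[R]_p.+2 => enorm (y - x)).
  apply: measurableT_comp; first exact: measurable_enorm.
  rewrite (_ : (fun y => y - x) = (fun y => (- x) + 1 *: y)).
    exact: measurable_rV_affine.
  by apply/funext => y; rewrite scale1r addrC.
have mA : measurable A.
  rewrite (_ : A = ((fun q : 'rV[R]_p.+2 * R => q.2 - enorm (q.1 - x)) @^-1` `[0, +oo[%classic)
    `&` (snd @^-1` `]0, r]%classic)).
    apply: measurableI; rewrite -[X in measurable X]setTI.
      have mm : measurable_fun setT (fun q : 'rV[R]_p.+2 * R => q.2 - enorm (q.1 - x)).
        apply: measurable_funB; first exact: measurable_snd.
        by apply: (measurableT_comp msub).
      by apply: mm => //; exact: measurable_itv.
    have ms : measurable_fun setT (snd : 'rV[R]_p.+2 * R -> R) by exact: measurable_snd.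
    by apply: ms => //; exact: measurable_itv.
  by apply/seteqP; split => q /=; rewrite !in_itv/= andbT subr_ge0.
pose k0 (q : 'rV[R]_p.+2 * R) : R := phi' q.1 * (p%:R * q.2 `^ (- p.+1%:R)).
pose k : 'rV[R]_p.+2 * R -> R := k0 \_ A.
have mk0 : measurable_fun setT k0.
  apply: measurable_funM; first by apply: (measurableT_comp mphi').
  apply: measurable_funM; first exact: measurable_cst.
  by apply: (measurableT_comp (measurable_powR _)).
have mk : measurable_fun setT k.
  by apply/(measurable_restrictT _ mA); exact: measurable_funTS.
have inA y rho : ((y, rho) \in A) = (0 < rho <= r) && (y \in eball x rho).
  apply/idP/andP => [/set_mem[/= yr ->]|[rr /set_mem yr]]; [split => //|]; apply/mem_set.
    by rewrite /eball/= -enormN opprB.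
  by split => //=; rewrite -enormN opprB.
have BB rho : rho <= r -> eball x rho `<=` eball x r.
  by move=> rr y; rewrite /eball/= => /le_trans; apply.
have kE y rho : k (y, rho) = if (0 < rho <= r) && (y \in eball x rho)
    then phi y * (p%:R * rho `^ (- p.+1%:R)) else 0.
  rewrite /k patchE inA; case: ifPn => // /andP[/andP[_ rr] /set_mem xy].
  by rewrite /k0/= /phi' patchE mem_set//; exact: BB xy.
have c0 rho : 0 <= p%:R * rho `^ (- p.+1%:R) by rewrite mulr_ge0 ?powR_ge0.
have M0 : 0 <= M.
  by apply: le_trans (MP x _); rewrite // /eball/= subrr enormE /sqn big1 ?sqrtr0 ?ltW// => i _;
    rewrite mxE expr0n.
have om0 : 0 <= omega p.+2 :> R by rewrite /omega fine_ge0.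
have phi_int rho : 0 < rho <= r ->
    (\int[lebesgue_rV p.+2]_(y in eball x rho) (phi y)%:E =
     (rho ^+ p.+2 * ball_mean phi x 0 rho)%:E)%E.
  move=> /andP[rho0 rr].
  rewrite (@integral_eball_affine _ _ x rho M phi)//; last 2 first.
  - exact: measurable_funS (BB _ rr) mphi.
  - by move=> y /(BB _ rr); exact: MP.
  rewrite [RHS]EFinM; congr (_ * _)%E; rewrite /ball_mean.
  under eq_Rintegral do rewrite expr0 mulr1.
  rewrite /Rintegral fineK//; apply: integrable_fin_num; first exact: measurable_eball.
  apply: (continuous_ball_integrable (@open_affine _ _ x rho _ oU)).
    by move=> z Bz; apply/BU/eball_affine => //; rewrite ltW.
  move=> z Vz; apply: (continuous_comp (@continuous_affine _ _ x rho z)); exact: cphi.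
have iphi rho : rho <= r -> (lebesgue_rV p.+2).-integrable (eball x rho) (EFin \o phi).
  move=> rr; apply: (bounded_integrable (mB rho) (eball_fin x rho) (M := M)).
    exact: measurable_funS (BB _ rr) mphi.
  by move=> y /(BB _ rr); exact: MP.
(* Absolute integrability by Tonelli: the integral of [|k|] over [y] is at most [M p rho^(-(p+1))
   omega rho^(p+2) = M p omega rho], which is bounded on []0, r]]. *)
have inner_abs rho : (\int[lebesgue_rV p.+2]_y `|(k (y, rho))%:E| <=
    ((cst (M * p%:R * omega p.+2 * r) \_ `]0, r]) rho)%:E)%E.
  rewrite patchE; case: ifPn => [/set_mem|].
    rewrite /= in_itv/= => rr; have /andP[rho0 rhor] := rr.
    have -> : (\int[lebesgue_rV p.+2]_y `|(k (y, rho))%:E| =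
      \int[lebesgue_rV p.+2]_(y in eball x rho)
        `|(phi y * (p%:R * rho `^ (- p.+1%:R)))%:E|)%E.
      rewrite [RHS]integral_mkcond; apply: eq_integral => y _.
      by rewrite patchE kE rr/=; case: ifP => // _; rewrite normr0.
    apply: (@le_trans _ _ ((M * (p%:R * rho `^ (- p.+1%:R)))%:E *
        lebesgue_rV p.+2 (eball x rho))%E).
      apply: integral_le_bound => //.
      - apply/measurable_EFinP; apply: measurable_funM; last exact: measurable_cst.
        exact: measurable_funS (BB _ rhor) mphi.
      - by rewrite lee_fin mulr_ge0 ?c0.
      - apply: aeW => y xy; rewrite lee_fin normrM [`|p%:R * _|]ger0_norm ?c0// ler_wpM2r ?c0//.
        by apply: MP; exact: BB xy.
    rewrite lebesgue_eball// -EFinM lee_fin powR_invn; last exact: ltW.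
    rewrite [leLHS](_ : _ = M * p%:R * omega p.+2 * rho).
      by rewrite ler_wpM2l// !mulr_ge0.
    by rewrite [rho ^+ p.+2]exprS; field; rewrite expf_neq0// gt_eqF.
  rewrite notin_setE/= in_itv/= => /negP/negbTE rr.
  by rewrite integral0_eq// => y _; rewrite kE rr/= normr0.
have mEk : measurable_fun setT (EFin \o k) by exact/measurable_EFinP.
have m0r : measurable (`]0, r]%classic : set (measurableTypeR R)) by exact: measurable_itv.
have ik : (lebesgue_rV p.+2 \x @lebesgue_measure R)%E.-integrable setT (EFin \o k).
  apply/integrable21ltyP => //.
  have iD : lebesgue_measure.-integrable setT
      (EFin \o (cst (M * p%:R * omega p.+2 * r) \_ `]0, r])).
    rewrite -restrict_EFin; apply/(integrable_mkcond _ m0r).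
    apply: (@bounded_integrable _ _ _ _ _ _ `|M * p%:R * omega p.+2 * r|) => //.
    by rewrite /= lebesgue_measure_itv/=; case: ifP => _; rewrite ?ltry// -EFinB ltry.
  apply: (@le_lt_trans _ _ (\int[lebesgue_measure]_rho
      ((cst (M * p%:R * omega p.+2 * r) \_ `]0%R, r]) rho)%:E)%E).
    apply: ge0_le_integral => //.
    - by move=> rho _; apply: integral_ge0.
    - apply: (measurable_fun_fubini_tonelli_G (m1 := lebesgue_rV p.+2) (abse \o (EFin \o k))).
        exact: measurableT_comp.
      by move=> q; exact: abse_ge0.
    - exact: measurable_int iD.
    - by move=> rho _; exact: inner_abs.
  by rewrite ltey_eq integrable_fin_num.
have inner_y rho : (\int[lebesgue_rV p.+2]_y (k (y, rho))%:E =
    (((fun rho => p%:R * (rho * ball_mean phi x 0 rho))%R \_ `]0%R, r]) rho)%:E)%E.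
  rewrite patchE; case: ifPn => [/set_mem|].
    rewrite /= in_itv/= => rr; have /andP[rho0 rhor] := rr.
    transitivity (\int[lebesgue_rV p.+2]_(y in eball x rho)
        ((phi y)%:E * (p%:R * rho `^ (- p.+1%:R))%:E))%E.
      rewrite [RHS]integral_mkcond; apply: eq_integral => y _.
      by rewrite patchE kE rr/=; case: ifP.
    rewrite integralZr//; last exact: iphi.
    rewrite phi_int// -EFinM; congr EFin.
    rewrite powR_invn; last exact: ltW.
    by rewrite [rho ^+ p.+2]exprS; field; rewrite expf_neq0// gt_eqF.
  rewrite notin_setE/= in_itv/= => /negP/negbTE rr.
  by rewrite integral0_eq// => y _; rewrite kE rr.
have inner_rho y : eball x r y -> y != x ->
    (\int[lebesgue_measure]_rho (k (y, rho))%:E =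
    (phi y / enorm (y - x) ^+ p - phi y * r `^ (- p%:R))%R%:E)%E.
  move=> xy yx; set s := enorm (y - x).
  have s0 : 0 < s.
    rewrite lt_def sqrtr_ge0 andbT; apply: contra_neq yx => sx.
    apply/eqP; rewrite -subr_eq0; apply/eqP/rowP => i.
    have := @eball_coord R _ 0 (- (y - x)) 0 i.
    rewrite /eball/= sub0r opprK -/s sx lexx => /(_ isT).
    by rewrite !mxE sub0r opprK normr_le0 => /eqP.
  have sr : s <= r by move: xy; rewrite /eball/= -enormN opprB.
  have srp : 0 < s <= r by rewrite s0.
  have [ii iE] := integral_inv_pow p srp.
  transitivity (\int[lebesgue_measure]_(rho in `[s, r])
      ((phi y)%:E * (p%:R * rho `^ (- p.+1%:R))%:E))%E.
    rewrite [RHS]integral_mkcond; apply: eq_integral => rho _.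
    rewrite patchE kE.
    have -> : (0 < rho <= r) && (y \in eball x rho) = (rho \in `[s, r]%classic).
      apply/idP/idP => [/andP[/andP[_ rr] /set_mem]|/set_mem/=].
        rewrite /eball/= -enormN opprB -/s => sr'; apply/mem_set.
        by rewrite /= in_itv/= sr' rr.
      rewrite in_itv/= => /andP[sr' rr]; rewrite rr (lt_le_trans s0 sr')/=.
      by apply/mem_set; rewrite /eball/= -enormN opprB.
    by case: ifP.
  rewrite integralZl// iE -EFinM mulrBr; congr EFin; congr (_ - _).
  by rewrite powR_invn// ltW.
have iF := integrable_fubini_F ik.
have iFB : (lebesgue_rV p.+2).-integrable (eball x r)
    (fun y => \int[lebesgue_measure]_rho (k (y, rho))%:E)%E.
  exact: integrableS iF.
have iR : (lebesgue_rV p.+2).-integrable (eball x r)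
    (fun y => (phi y)%:E * (r `^ (- p%:R))%:E)%E.
  by apply: integrableZr => //; exact: iphi.
rewrite (@ae_eq_integral _ _ _ _ _ (fun y => (phi y)%:E * (r `^ (- p%:R))%:E +
    \int[lebesgue_measure]_rho (k (y, rho))%:E)%E)//; last 3 first.
- apply/measurable_EFinP; apply: measurable_funM => //.
  apply: (@eq_measurable_fun _ _ _ _ _ (fun y : 'rV[R]_p.+2 => enorm (y - x) `^ (- p%:R))).
    by move=> y _; rewrite powR_invn// sqrtr_ge0.
  by apply: measurable_funTS; apply: (measurableT_comp (measurable_powR _)).
- exact: measurable_int (integrableD (mB r) iR iFB).
(* The centre is the only exceptional point, and it is a null set. *)
- exists [set x]; split; [exact: measurable_rV_set1|exact: lebesgue_rV_set1|].
  move=> y /=; apply: contra_notP => yx xy; rewrite inner_rho//; last exact/eqP.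
  by rewrite -EFinM -EFinD subrKC.
rewrite integralD// integralZr//; last exact: iphi.
rewrite phi_int ?r0 ?lexx// -EFinM.
have -> : (\int[lebesgue_rV p.+2]_(y in eball x r)
    \int[lebesgue_measure]_rho (k (y, rho))%:E =
  \int[lebesgue_rV p.+2]_y \int[lebesgue_measure]_rho (k (y, rho))%:E)%E.
  rewrite integral_mkcond; apply: eq_integral => y _; rewrite patchE; case: ifPn => // xy.
  rewrite integral0_eq// => rho _; rewrite kE; case: ifPn => // /andP[/andP[_ rr]].
  by move=> /set_mem/(BB _ rr)/mem_set; rewrite (negPf xy).
rewrite (Fubini ik); under [X in (_ + X)%E]eq_integral do rewrite inner_y.
pose h rho := p%:R * (rho * ball_mean phi x 0 rho).
have iG := ball_mean_mul_integrable 0 oU BU cphi.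
have ih : lebesgue_measure.-integrable `[0, r] (EFin \o h).
  rewrite (_ : _ \o _ = (fun t => p%:R%:E * (t * ball_mean phi x 0 t)%:E)%E)//.
  exact: integrableZl.
have ih' : lebesgue_measure.-integrable `]0, r] (EFin \o h).
  apply: (integrableS _ _ _ ih).
  - exact: measurable_itv.
  - exact: measurable_itv.
  - by move=> t; rewrite /= !in_itv/= => /andP[t0 ->]; rewrite ltW.
have -> : (\int[lebesgue_measure]_rho ((h \_ `]0%R, r]) rho)%:E =
    (p%:R * \int[lebesgue_measure]_(rho in `[0%R, r]) (rho * ball_mean phi x 0 rho))%R%:E)%E.
  rewrite -RintegralZl// -Rintegral_itv_obnd_cbnd// /Rintegral fineK.
    by rewrite [RHS]integral_mkcond; apply: eq_integral => t _; rewrite !patchE; case: ifP.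
  by apply: integrable_fin_num => //.
rewrite -EFinD; congr (_ + _)%:E; rewrite powR_invn; last exact: ltW.
have -> : r ^+ p.+2 = r ^+ p * r ^+ 2 by rewrite -exprD addn2.
field.
by rewrite expf_neq0// gt_eqF.
Qed.

End layer_cake.

(** * The Bessel side *)

Section bessel.
Context {R : realType}.

(* [(t^(2k+2) / (2k+2)) * Q_coef n k] is, up to the factor
   [Gamma (n/2) n omega_n], the [k]-th term of the expansion of [Q n t]. *)
Definition Q_coef (n k : nat) : R :=
  (-1) ^+ k * 4 ^- k / (k`!%:R * Gamma (n%:R / 2 + k%:R)).

(** By the recurrence each step multiplies by [n/2 + k], which exceeds 1. *)
Lemma Gamma_half_ge (n k : nat) : (3 <= n)%N ->
  Gamma (n%:R / 2) <= Gamma (n%:R / 2 + k%:R) :> R.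
Proof.
move=> n3; have h1 : 1 < n%:R / 2 :> R.
  by rewrite ltr_pdivlMr// mul1r ltr_nat.
elim: k => [|k IH]; first by rewrite addr0.
apply: le_trans IH _; rewrite -[k.+1%:R]natr1 addrA GammaS; last by rewrite ltr_wpDr.
rewrite ler_peMl//; last by rewrite (le_trans (ltW h1))// lerDl.
by rewrite ltW// Gamma_gt0// ltW// ltr_wpDr.
Qed.

(** The growth condition of the odd power series with [a = 1], after bounding [4^-k] by 1. *)
Lemma Q_coef_bound (n : nat) : (3 <= n)%N -> forall k,
  `|Q_coef n k| <= (Gamma (n%:R / 2))^-1 * 1 ^+ k / k`!%:R.
Proof.
move=> n3 k; have h1 : 1 <= n%:R / 2 :> R.
  by rewrite ler_pdivlMr// mul1r ler_nat ltnW.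
have g0 := Gamma_gt0 h1; have gk := Gamma_half_ge k n3.
have gk0 := lt_le_trans g0 gk.
have -> : `|Q_coef n k| = 4 ^- k * (Gamma (n%:R / 2 + k%:R))^-1 / k`!%:R.
  rewrite /Q_coef !normrM normrX normrN1 expr1n mul1r !normfV normrM.
  rewrite !ger0_norm ?exprn_ge0 ?(ltW gk0)//.
  by rewrite invfM mulrA mulrAC.
rewrite ler_wpM2r ?invr_ge0// expr1n mulr1 -[leRHS]mul1r ler_pM//.
- by rewrite invr_ge0 ltW.
- by rewrite invf_le1 ?exprn_gt0// exprn_ege1// ler1n.
- by rewrite lef_pV2.
Qed.

(** The real exponents add up: [s^((4-n)/2) s^(2k + (n-2)/2) = s^(2k+1)]. This is why the prefactor
    in [Q] turns the Bessel series into an odd power series. *)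
Lemma bessel_term (n k : nat) (s : R) : (3 <= n)%N -> 0 < s ->
  s `^ ((4 - n%:R) / 2) * ((-1) ^+ k / (k`!%:R * Gamma (k%:R + (n%:R - 2) / 2 + 1))
      * (s / 2) `^ (2 * k%:R + (n%:R - 2) / 2)) =
  2 `^ (- ((n%:R - 2) / 2)) * (Q_coef n k * s ^+ (2 * k).+1).
Proof.
move=> n3 s0; have s0' := ltW s0.
have -> : k%:R + (n%:R - 2) / 2 + 1 = n%:R / 2 + k%:R :> R by field.
rewrite powRM// ?invr_ge0//.
have -> : (2^-1 : R) `^ (2 * k%:R + (n%:R - 2) / 2) =
    4 ^- k * 2 `^ (- ((n%:R - 2) / 2)).
  rewrite -powR_inv1// -powRrM mulN1r opprD powRD; last by rewrite pnatr_eq0 implybT.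
  have -> : 4 = 2 ^+ 2 :> R by rewrite -natrX.
  by rewrite -exprM -natrM powR_invn.
have -> : s ^+ (2 * k).+1 = s `^ ((4 - n%:R) / 2) * s `^ (2 * k%:R + (n%:R - 2) / 2).
  rewrite -powRD; last by apply/implyP => _; rewrite gt_eqF.
  rewrite -powR_mulrn//; congr (_ `^ _); rewrite -[(2 * k).+1%:R]natr1 natrM; by field.
by rewrite /Q_coef; ring.
Qed.

(** [besselJ] is a [limn], informative only once convergence is known; convergence is first
    established for the odd series and then transferred to the Bessel series. *)
Lemma cvg_bessel (n : nat) (s : R) : (3 <= n)%N -> 0 <= s ->
  series (fun k => Q_coef n k * s ^+ (2 * k).+1) @ \oo -->
    2 `^ ((n%:R - 2) / 2) *
      (s `^ ((4 - n%:R) / 2) * besselJ ((n%:R - 2) / 2) s).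
Proof.
(* At [s = 0] the order [(n-2)/2] is positive, so [besselJ] is 0 there and the product is 0 whatever
   the value of [s^((4-n)/2)]. *)
move=> n3; rewrite le_eqVlt => /predU1P[<-|s0].
  have nu0 : (n%:R - 2) / 2 > 0 :> R by rewrite divr_gt0// subr_gt0 ltr_nat.
  have -> : besselJ ((n%:R - 2) / 2) 0 = 0 :> R.
    rewrite /besselJ (_ : series _ = cst 0); first exact: lim_cst.
    apply/funext => N; rewrite /series/= big1// => k _.
    by rewrite mul0r powR0 ?mulr0// gt_eqF// ltr_wpDl.
  rewrite !mulr0 (_ : series _ = cst 0); first exact: cvg_cst.
  by apply/funext => N; rewrite /series/= big1// => k _; rewrite expr0n mulr0.
have cv := cvg_odd_series (ltW s0) ler01 (Q_coef_bound n3).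
pose c : R := s `^ (- ((4 - n%:R) / 2)) * 2 `^ (- ((n%:R - 2) / 2)).
have E : besselJ ((n%:R - 2) / 2) s =
    c * limn (series (fun k => Q_coef n k * s ^+ (2 * k).+1)).
  transitivity (limn (fun N => c * series (fun k => Q_coef n k * s ^+ (2 * k).+1) N)).
    congr (limn _).
    apply/funext => N; rewrite /series/= mulr_sumr; apply: eq_bigr => k _.
    rewrite /c -[RHS]mulrA -bessel_term// [RHS]mulrA -powRD; last first.
      by apply/implyP => _; rewrite gt_eqF.
    by rewrite addNr powRr0 mul1r.
  by apply: cvg_lim => //; apply: cvgMr; exact: cv.
suff -> : 2 `^ ((n%:R - 2) / 2) * (s `^ ((4 - n%:R) / 2) * besselJ ((n%:R - 2) / 2) s) =
   limn (series (fun k => Q_coef n k * s ^+ (2 * k).+1)) by [].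
rewrite E /c !powRN; field.
by rewrite !gt_eqF ?powR_gt0.
Qed.

(** Termwise integration of the Bessel series; the factor [2^((n-2)/2)] in [Q] cancels the
    [2^(-(n-2)/2)] coming from the powers of [s/2]. *)
Lemma cvg_Q (n : nat) (t : R) : (3 <= n)%N -> 0 <= t ->
  series (fun k => Gamma (n%:R / 2) * n%:R * omega n * Q_coef n k *
     (t ^+ (2 * k).+2 / (2 * k).+2%:R)) @ \oo --> Q n t.
Proof.
move=> n3 t0; set nu : R := (n%:R - 2) / 2.
pose f (s : R) := s `^ ((4 - n%:R) / 2) * besselJ nu s.
have p0 : 0 < 2 `^ (- nu) by rewrite powR_gt0.
pose d k := 2 `^ (- nu) * Q_coef n k.
have dC k : `|d k| <= 2 `^ (- nu) / Gamma (n%:R / 2) * 1 ^+ k / k`!%:R.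
  rewrite /d normrM (ger0_norm (ltW p0)) -!mulrA ler_wpM2l ?(ltW p0)//.
  by rewrite mulrA; exact: Q_coef_bound.
have dE s : 0 <= s <= t -> series (fun k => d k * s ^+ (2 * k).+1) @ \oo --> f s.
  move=> /andP[s0 _].
  have -> : series (fun k => d k * s ^+ (2 * k).+1) =
      (fun N => 2 `^ (- nu) * series (fun k => Q_coef n k * s ^+ (2 * k).+1) N).
    by apply/funext => N; rewrite /series/= mulr_sumr; apply: eq_bigr => k _; rewrite /d mulrA.
  have -> : f s = 2 `^ (- nu) * (2 `^ nu * f s).
    by rewrite mulrA -powRD ?addNr ?powRr0 ?mul1r// pnatr_eq0 implybT.
  by apply: cvgMr; exact: cvg_bessel.
have iQ := integral_odd_series t0 ler01 dC dE.
have -> : series (fun k => Gamma (n%:R / 2) * n%:R * omega n * Q_coef n k *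
     (t ^+ (2 * k).+2 / (2 * k).+2%:R)) =
   (fun N => 2 `^ nu * Gamma (n%:R / 2) * n%:R * omega n *
     series (fun k => d k * (t ^+ (2 * k).+2 / (2 * k).+2%:R)) N).
  apply/funext => N; rewrite /series/= mulr_sumr; apply: eq_bigr => k _.
  rewrite /d powRN; set q := (t ^+ _ / _); field.
  by rewrite lt0r_neq0// powR_gt0.
by apply: cvgMr; exact: iQ.
Qed.

End bessel.

(** * Comparison of the two power series *)

Section newtonian_mean.
Context {R : realType}.

(** The Beta-integral value [c_k = omega_n Gamma(n/2 + 1) k! / Gamma(n/2 + k + 1)], cleared of
    denominators and with each [Gamma (a + 1)] split as [a Gamma a]. Induction on [k] matches
    [ball_moment_rec] with the recurrence of [Gamma]. *)
Lemma ball_moment_Gamma (n k : nat) : (3 <= n)%N ->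
  ball_moment n k * Gamma (n%:R / 2 + k%:R) * (n%:R / 2 + k%:R) =
  omega n * Gamma (n%:R / 2) * (n%:R / 2) * k`!%:R :> R.
Proof.
move=> n3; have h1 : 1 < n%:R / 2 :> R.
  by rewrite ltr_pdivlMr// mul1r ltr_nat.
elim: k => [|k IH]; first by rewrite addr0 fact0 mulr1 ball_moment0 mulrA.
rewrite factS natrM -[k.+1%:R in LHS]natr1 addrA GammaS; last by rewrite ltr_wpDr.
rewrite [RHS]mulrCA -IH (ball_moment_rec n k) -[k.+1%:R]natr1; field.
by rewrite gt_eqF// ltr_wpDl.
Qed.

Lemma ball_moment_ge0 (n k : nat) : 0 <= ball_moment n k :> R.
Proof.
apply: Rintegral_ge0 => z /eball01E z1; rewrite exprn_ge0//.
by rewrite subr_ge0.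
Qed.

Lemma ball_moment_le (n k : nat) : ball_moment n k <= omega n :> R.
Proof.
elim: k => [|k IH]; first by rewrite ball_moment0.
apply: le_trans IH; rewrite [leRHS]ball_moment_rec ler_peMr ?ball_moment_ge0//.
by rewrite lerDl divr_ge0// mulr_ge0.
Qed.

(** Both sides are limits of series in even powers of [r], whose partial sums are shown to be equal
    term by term; uniqueness of limits concludes. *)
Lemma newtonian_mean (p : nat) (lambda r : R) (x : 'rV[R]_p.+2)
    (phi : 'rV[R]_p.+2 -> R) (U : set 'rV[R]_p.+2) :
  (0 < p)%N -> 0 < lambda -> 0 < r -> open U -> eball x r `<=` U -> C2_on U phi ->
  (forall y, U y -> - laplacian phi y = lambda * phi y) ->
  (\int[lebesgue_rV p.+2]_(y in eball x r) (phi y / enorm (y - x) ^+ p)%:E)%E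
  = (lambda^-1 * Q p.+2 (Num.sqrt lambda * r) * phi x)%:E.
Proof.
move=> p0 l0 r0 oU BU C2 eig.
have cphi y : U y -> {for y, continuous phi} by move=> /C2[].
have n3 : (3 <= p.+2)%N by [].
rewrite (layer_cake p0 r0 oU BU cphi); congr EFin.
pose d k := phi x * mean_coef p.+2 lambda 0 k.
have dC k : `|d k| <= `|phi x| * omega p.+2 * (lambda / 4) ^+ k / k`!%:R.
  have l4 : 0 <= lambda / 4 by rewrite divr_ge0// ltW.
  have kk : 0 <= (k`!%:R * k`!%:R)^-1 :> R by rewrite invr_ge0 mulr_ge0.
  rewrite /d /mean_coef add0n fact0 mulr1 !normrM normrX normrN.
  rewrite (ger0_norm l4) (ger0_norm (ball_moment_ge0 _ _)) (ger0_norm kk) invfM.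
  have f1 : k`!%:R^-1 <= 1 :> R by rewrite invf_le1 ?ltr0n ?fact_gt0// ler1n fact_gt0.
  rewrite -!mulrA ler_wpM2l// [leRHS]mulrCA ler_wpM2l ?exprn_ge0//.
  rewrite mulrA ler_wpM2r ?invr_ge0//.
  by apply: le_trans (ball_moment_le _ k); rewrite ler_piMr ?ball_moment_ge0.
pose G rho := ball_mean phi x 0 rho.
have cG rho : 0 <= rho <= r ->
    series (fun k => d k * rho ^+ (2 * k).+1) @ \oo --> rho * G rho.
  move=> rr; have -> : series (fun k => d k * rho ^+ (2 * k).+1) =
      (fun N => rho * series (fun k => phi x * mean_coef p.+2 lambda 0 k * rho ^+ (2 * k)) N).
    apply/funext => N; rewrite /series/= mulr_sumr; apply: eq_bigr => k _.
    by rewrite /d exprS mulrCA.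
  by apply: cvgMr; exact: cvg_ball_mean C2 eig rr.
have l4 : 0 <= lambda / 4 by rewrite divr_ge0// ltW.
have iG := integral_odd_series (ltW r0) l4 dC cG.
have rr : 0 <= r <= r by rewrite ltW/=.
have cH : r * series (fun k => d k * r ^+ (2 * k).+1) N +
    p%:R * series (fun k => d k * (r ^+ (2 * k).+2 / (2 * k).+2%:R)) N @[N --> \oo] -->
    r * (r * G r) + p%:R * \int[lebesgue_measure]_(rho in `[0, r]) (rho * G rho).
  by apply: cvgD; apply: cvgMr; [exact: cG|exact: iG].
have t0 : 0 <= Num.sqrt lambda * r by rewrite mulr_ge0 ?sqrtr_ge0// ltW.
have cQ : lambda^-1 * series (fun k => Gamma (p.+2%:R / 2) * p.+2%:R * omega p.+2 *
    Q_coef p.+2 k * ((Num.sqrt lambda * r) ^+ (2 * k).+2 / (2 * k).+2%:R)) N * phi x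
    @[N --> \oo] --> lambda^-1 * Q p.+2 (Num.sqrt lambda * r) * phi x.
  by apply: cvgMl; apply: cvgMr; exact: cvg_Q.
rewrite expr2 -mulrA.
pose SH N := r * series (fun k => d k * r ^+ (2 * k).+1) N +
    p%:R * series (fun k => d k * (r ^+ (2 * k).+2 / (2 * k).+2%:R)) N.
suff SHE : SH = (fun N => lambda^-1 * series (fun k =>
    Gamma (p.+2%:R / 2) * p.+2%:R * omega p.+2 * Q_coef p.+2 k *
    ((Num.sqrt lambda * r) ^+ (2 * k).+2 / (2 * k).+2%:R)) N * phi x).
  have {}cH : SH @ \oo --> _ := cH.
  by rewrite SHE in cH; exact: cvg_unique cH cQ.
(* The boundary term and the integral together give [d k * (1 + p / (2k+2)) = d k * (2k+n) /
   (2k+2)]. The factor [n/2 + k] thus produced cancels the one in the denominator of the moment. *)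
rewrite /SH; apply/funext => N; rewrite /series/= !mulr_sumr -big_split/= mulr_suml.
apply: eq_bigr => k _.
have h1 : 1 <= p.+2%:R / 2 :> R by rewrite ler_pdivlMr// mul1r ler_nat.
have g0 : 0 < Gamma (p.+2%:R / 2 + k%:R) :> R.
  by apply: Gamma_gt0; rewrite (le_trans h1)// lerDl.
have hk0 : 0 < p.+2%:R / 2 + k%:R :> R by rewrite (lt_le_trans _ (le_trans h1 _))// lerDl.
have cE : ball_moment p.+2 k = omega p.+2 * Gamma (p.+2%:R / 2) * (p.+2%:R / 2) *
    k`!%:R / (Gamma (p.+2%:R / 2 + k%:R) * (p.+2%:R / 2 + k%:R)) :> R.
  apply: (canRL (mulfK _)); first by rewrite mulf_neq0 ?gt_eqF.
  by rewrite mulrA ball_moment_Gamma.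
have sE : (Num.sqrt lambda * r) ^+ (2 * k).+2 = lambda ^+ k * lambda * r ^+ (2 * k).+2.
  have -> : (2 * k).+2 = (2 * k.+1)%N by rewrite mulnS.
  by rewrite exprMn exprM sqr_sqrtr ?(ltW l0)// exprSr.
rewrite sE /d /mean_coef add0n fact0 cE /Q_coef (exprNn (lambda / 4)) expr_div_n.
have kf : k`!%:R != 0 :> R by rewrite pnatr_eq0 -lt0n fact_gt0.
have l0' : lambda != 0 by rewrite gt_eqF.
have g0' : Gamma (p.+2%:R / 2 + k%:R) != 0 :> R by rewrite gt_eqF.
have hk0' : p.+2%:R / 2 + k%:R != 0 :> R by rewrite gt_eqF.
have k2 : (2 * k).+2%:R = 2 * k%:R + 2 :> R by rewrite -addn2 natrD natrM.
have k20 : 2 * k%:R + 2 != 0 :> R by rewrite -k2 pnatr_eq0.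
have p2 : p.+2%:R = p%:R + 2 :> R by rewrite -addn2 natrD.
rewrite k2 (exprS r (2 * k).+1); move: g0' hk0'; set g := Gamma (_ + k%:R); set gh := Gamma (_ / 2).
rewrite p2 => g0' hk0'.
field.
by rewrite k20 g0' kf l0' expf_neq0 ?pnatr_eq0//=.
Qed.

End newtonian_mean.

(** * Dimension three *)

Section dimension_three.
Context {R : realType}.

Lemma sqn_cons n (a : R) (v : 'rV[R]_n) : sqn (rV_cons (a, v)) = a ^+ 2 + sqn v.
Proof.
rewrite /sqn big_ord_recl rV_cons0; congr (_ + _).
by apply: eq_bigr => k _; rewrite rV_consS.
Qed.

(** Substitution [a = sin t] on [[-pi/2, pi/2]], where [cos] is nonnegative and so equals the
    root. *)
Lemma integral_half_circle :
  (\int[lebesgue_measure]_(a in `[(-1)%R, 1%R]) (Num.sqrt (1 - a ^+ 2))%:E =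
   (pi / 2 : R)%:E)%E.
Proof.
have dsin : derive1 (@sin R) = cos.
  by apply/funext => t; rewrite derive1E; exact: derive_val.
have pi0 := pi_gt0 R.
have pp : - (pi / 2) < pi / 2 :> R by rewrite gtrN// divr_gt0.
have LRsin : derivable_oo_LRcontinuous (@sin R) (- (pi / 2)) (pi / 2).
  split=> [t _||]; first exact: ex_derive.
  - by apply: cvg_at_right_filter; exact: continuous_sin.
  - by apply: cvg_at_left_filter; exact: continuous_sin.
have := @integration_by_substitution_increasing R sin (fun a => Num.sqrt (1 - a ^+ 2))
  (- (pi / 2)) (pi / 2) (ltW pp).
rewrite sinN sin_pihalf dsin => ->//.
(* An antiderivative of [cos^2]. *)
- pose F : R -> R := fun t => (t + sin t * cos t) / 2.
  have dF (t : R) : is_derive t 1 F (cos t ^+ 2).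
    have -> : F = (2^-1 : R) \*: (id + sin * cos).
      by apply/funext => u; rewrite /F /= !fctE /GRing.scale/= mulrC.
    apply: is_derive_eq; rewrite /GRing.scale/= ?fctE.
    by rewrite [cos t * _]mulrC mulrN -!expr2 sin2cos2; field.
  transitivity (\int[lebesgue_measure]_(t in `[(- (pi / 2 : R))%R, (pi / 2)%R]) (cos t ^+ 2)%R%:E)%E.
    apply: eq_integral => t /set_mem/=; rewrite in_itv/= => tp; congr EFin.
    by rewrite fctE/= -cos2sin2 sqrtr_sqr ger0_norm ?cos_ge0_pihalf// expr2.
  rewrite (@continuous_FTC2 _ _ F)//.
  + by rewrite /F cosN sinN cos_pihalf !mulr0 !addr0 -EFinB; congr EFin; field.
  + apply: continuous_subspaceT => t.
    apply: (@continuous_comp _ R R cos (fun y : R => y ^+ 2)); first exact: continuous_cos.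
    exact: exprn_continuous.
  + have cF (t : R) : {for t, continuous F}.
      by apply: differentiable_continuous; apply/derivable1_diffP; have [] := dF t.
    split=> [t _||]; first by have [] := dF t.
    * by apply: cvg_at_right_filter; exact: cF.
    * by apply: cvg_at_left_filter; exact: cF.
  + by move=> t _; rewrite derive1E; have [] := dF t.
- by move=> a b aI bI ab; rewrite ltr_sin.
- by move=> t _; exact: continuous_cos.
- by apply/cvg_ex; exists (cos (- (pi / 2))); apply: cvg_at_right_filter; exact: continuous_cos.
- by apply/cvg_ex; exists (cos (pi / 2)); apply: cvg_at_left_filter; exact: continuous_cos.
- apply: continuous_subspaceT => a.
  apply: (@continuous_comp _ R R (fun a : R => 1 - a ^+ 2) (@Num.sqrt R));
    last exact: sqrt_continuous.
  by apply: cvgB; [exact: cvg_cst|exact: exprn_continuous].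
Qed.

(** The section of the unit ball at first coordinate [a] is a ball of radius [sqrt(1 - a^2)] in
    dimension [n], whose volume follows by scaling. *)
Lemma omega_rec n : (0 < n)%N -> (omega n.+1)%:E =
  (\int[lebesgue_measure]_(a in `[(-1)%R, 1%R])
     (Num.sqrt (1 - a ^+ 2) ^+ n * omega n)%:E)%E :> \bar R.
Proof.
move=> n0; rewrite /omega fineK; last by rewrite ge0_fin_numE// eball_fin.
rewrite /= /lebesgue_rV_cons /pushforward /= /product_measure1 [RHS]integral_mkcond.
apply: eq_integral => a _ /=; rewrite patchE.
have sec (v : 'rV[R]_n) : xsection (@rV_cons R n @^-1` eball 0 1) a v <-> a ^+ 2 + sqn v <= 1.
  by rewrite /xsection/= inE/= eball01E sqn_cons.
case: ifPn => [/set_mem/=|].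
  rewrite in_itv/= -ler_norml => a1.
  have a2 : 0 <= 1 - a ^+ 2 by rewrite subr_ge0 -real_normK ?num_real// expr_le1.
  have -> : xsection (@rV_cons R n @^-1` eball 0 1) a = eball 0 (Num.sqrt (1 - a ^+ 2)).
    apply/seteqP; split => v.
      move=> /sec v1; apply/eballE; first exact: sqrtr_ge0.
      by rewrite sqr_sqrtr// sub0r -scaleN1r sqnZ sqrrN expr1n mul1r lerBrDl.
    move=> /eballE; rewrite sqrtr_ge0 sqr_sqrtr// sub0r -scaleN1r sqnZ sqrrN expr1n mul1r.
    by move=> /(_ isT) v1; apply/sec; rewrite -lerBrDl.
  (* For [a = 1] or [a = -1] the section is a single point, null because [n > 0]. *)
  have [s0|s0] := eqVneq (Num.sqrt (1 - a ^+ 2)) 0; last first.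
    by apply: lebesgue_eball; rewrite lt_def s0 sqrtr_ge0.
  rewrite s0 expr0n gtn_eqF// mul0r; case: n n0 sec => // n _ _.
  rewrite (_ : eball 0 0 = [set 0]) ?lebesgue_rV_set1//.
  apply/seteqP; split => [v v0|_ ->]; last first.
    by rewrite /eball/= subr0 enormE /sqn big1 ?sqrtr0// => i _; rewrite mxE expr0n.
  apply/rowP => i; have := eball_coord i v0.
  by rewrite !mxE sub0r normrN normr_le0 => /eqP.
rewrite notin_setE/= in_itv/= -ler_norml => /negP a1.
rewrite (_ : xsection _ _ = set0) ?measure0//.
apply/seteqP; split => // v /sec av; case: a1.
rewrite -(@expr_le1 _ 2)// real_normK ?num_real//.
by move=> /negP[]; apply: le_trans av; rewrite lerDl sqn_ge0.
Qed.

Lemma omega1 : omega 1 = 2 :> R.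
Proof.
rewrite /omega (_ : eball 0 1 = rV_box (fun=> `[-1, 1]%classic)).
  transitivity (fine (\prod_(i < 1)
    lebesgue_measure (`[(-1)%R, 1%R]%classic : set (measurableTypeR R)))%E).
    by congr fine; apply: lebesgue_rV_box => i; exact: measurable_itv.
  rewrite big_ord1 /= lebesgue_measure_itv/= lte_fin gtrN//=; ring.
apply/seteqP; split => z.
  move=> /eball_coord h i; rewrite /= in_itv/= -ler_norml; have := h i.
  by rewrite mxE sub0r normrN.
move=> /(_ ord0)/=; rewrite in_itv/= -ler_norml => h; apply/eball01E.
by rewrite /sqn big_ord1 -real_normK ?num_real// expr_le1.
Qed.

Lemma omega2 : omega 2 = pi :> R.
Proof.
apply: EFin_inj; rewrite omega_rec//.
under eq_integral do rewrite omega1 expr1 EFinM.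
rewrite integralZr//.
  by rewrite integral_half_circle -EFinM; congr EFin; field.
apply: continuous_compact_integrable; first exact: segment_compact.
apply: continuous_subspaceT => a.
apply: (@continuous_comp _ R R (fun a : R => 1 - a ^+ 2) (@Num.sqrt R));
  last exact: sqrt_continuous.
by apply: cvgB; [exact: cvg_cst|exact: exprn_continuous].
Qed.

Lemma omega3 : omega 3 = 4 / 3 * pi :> R.
Proof.
apply: EFin_inj; rewrite omega_rec//.
pose F : R -> R := pi \*: (id - 3^-1 \*: id ^+ 3).
have FE a : F a = pi * (a - a ^+ 3 / 3).
  by rewrite /F/= !fctE /GRing.scale/=; congr (_ * (_ - _)); rewrite mulrC.
have dF (a : R) : is_derive a 1 F ((1 - a ^+ 2) * pi).
  by apply: is_derive_eq; rewrite /GRing.scale/=; field.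
have cF (a : R) : {for a, continuous F}.
  by apply: differentiable_continuous; apply/derivable1_diffP; have [] := dF a.
transitivity (\int[lebesgue_measure]_(a in `[(-1)%R, 1%R]) ((1 - a ^+ 2) * pi : R)%R%:E)%E.
  apply: eq_integral => a /set_mem/=; rewrite in_itv/= -ler_norml => a1.
  by rewrite omega2 sqr_sqrtr// subr_ge0 -real_normK ?num_real// expr_le1.
rewrite (@continuous_FTC2 _ _ F)//.
- by rewrite !FE -EFinB; congr EFin; field.
- apply: continuous_subspaceT => a; apply: cvgM; last exact: cvg_cst.
  by apply: cvgB; [exact: cvg_cst|exact: exprn_continuous].
- split=> [a _||]; first by have [] := dF a.
  + by apply: cvg_at_right_filter; exact: cF.
  + by apply: cvg_at_left_filter; exact: cF.
- by move=> a _; rewrite derive1E; have [] := dF a.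
Qed.

(** The series of [Q 3] is identified with that of [4 pi (1 - cos t)] directly; the prefactor is
    [Gamma(3/2) * 3 * (4/3) pi], and [Gamma(3/2)] cancels against the coefficients. *)
Lemma Q3 (t : R) : 0 <= t -> Q 3 t = 4 * pi * (1 - cos t).
Proof.
move=> t0; have cQ := cvg_Q (isT : (3 <= 3)%N) t0.
(* A case of the duplication formula: raising [k] by one multiplies both sides by
   [(2k+2) (2k+3)]. *)
have GE k : Gamma (3 / 2 + k%:R) * 4 ^+ k * k`!%:R = Gamma (3 / 2) * (2 * k).+1`!%:R :> R.
  elim: k => [|k IH]; first by rewrite addr0 muln0 mulr1.
  have k1 : 1 < 3 / 2 + k%:R :> R by rewrite ltr_wpDr// ltr_pdivlMr// mul1r ltr_nat.
  have -> : (2 * k.+1).+1`!%:R =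
      (2 * k).+3%:R * ((2 * k).+2%:R * (2 * k).+1`!%:R) :> R.
    by rewrite -!natrM mulnS.
  have -> : k.+1`!%:R = k.+1%:R * k`!%:R :> R by rewrite -natrM.
  rewrite -[k.+1%:R in LHS]natr1 addrA GammaS//.
  transitivity ((2 * k).+3%:R * (2 * k).+2%:R * (Gamma (3 / 2) * (2 * k).+1`!%:R) : R).
    have -> : (2 * k).+3%:R = 2 * k%:R + 3 :> R by rewrite -addn3 natrD natrM.
    have -> : (2 * k).+2%:R = 2 * k%:R + 2 :> R by rewrite -addn2 natrD natrM.
    by rewrite -IH exprS; field.
  by rewrite -mulrA [RHS]mulrCA; congr (_ * _); rewrite [RHS]mulrCA.
(* The shift by one index removes the constant term of the cosine series, cancelled by the 1; term
   [k] of [Q] then faces term [k+1] of the cosine. *)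
have cC : (4 * pi * (1 - series (cos_coeff' t) N.+1) : R) @[N --> \oo] --> 4 * pi * (1 - cos t).
  apply: cvgMr; apply: cvgB; first exact: cvg_cst.
  by rewrite cvg_shiftS; exact: cvg_cos_coeff'.
apply: (cvg_unique _ cQ) => //.
set S := series _.
suff -> : S = (fun N => 4 * pi * (1 - series (cos_coeff' t) N.+1)) by [].
apply/funext => N; rewrite /S /series/= big_nat_recl// {1}/cos_coeff'.
rewrite expr0z double0 expr0 fact0 mul1r divr1 opprD addrA subrr add0r -sumrN mulr_sumr.
apply: eq_bigr => k _; rewrite /cos_coeff' omega3 /Q_coef.
rewrite -[_ ^ k.+1]/(_ ^+ k.+1) -mul2n mulnS.
have kf : k`!%:R != 0 :> R by rewrite pnatr_eq0 -lt0n fact_gt0.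
have g1 : Gamma (3 / 2) != 0 :> R.
  by rewrite gt_eqF// Gamma_gt0// ler_pdivlMr// mul1r ler_nat.
have k4 : 4 ^+ k != 0 :> R by rewrite expf_neq0// pnatr_eq0.
have -> : (2 + 2 * k)`!%:R = (2 * k).+2%:R * (2 * k).+1`!%:R :> R by rewrite -natrM.
have gE : Gamma (3 / 2 + k%:R) = Gamma (3 / 2) * (2 * k).+1`!%:R / (4 ^+ k * k`!%:R) :> R.
  by apply: (canRL (mulfK _)); rewrite ?mulf_neq0// mulrA GE.
have f1 : (2 * k).+1`!%:R != 0 :> R by rewrite pnatr_eq0 -lt0n fact_gt0.
have k2 : (2 * k).+2%:R != 0 :> R by rewrite pnatr_eq0.
rewrite gE; move: f1 k2; set X := (2 * k).+1`!%:R; set Y := (2 * k).+2%:R => f1 k2.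
have k20 : 2 + 2 * k%:R != 0 :> R by rewrite -natrM -natrD pnatr_eq0.
rewrite (exprS (-1) k) -[(2 + 2 * k)%N]/(2 * k).+2; field.
by rewrite f1 k20 kf k4 g1.
Qed.

End dimension_three.

Unset Implicit Arguments.

Theorem theorem4 (R : realType) (n : nat) (hn : (3 <= n)%N)
    (lambda r : R) (lambda_gt0 : 0 < lambda) (r_gt0 : 0 < r)
    (x : 'rV[R]_n) (phi : 'rV[R]_n -> R)
    (U : set 'rV[R]_n) (U_open : open U) (ball_U : eball x r `<=` U)
    (phi_C2 : C2_on U phi)
    (phi_eigen : forall y, U y -> - laplacian phi y = lambda * phi y) :
  (\int[lebesgue_rV n]_(y in eball x r)
      (phi y / enorm (y - x) ^+ (n - 2))%:E)%E
    = (lambda^-1 * Q n (Num.sqrt lambda * r) * phi x)%:E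
  /\
  (n = 3%N ->
   (\int[lebesgue_rV n]_(y in eball x r) (phi y / enorm (y - x))%:E)%E
     = (4 * pi * ((1 - cos (Num.sqrt lambda * r)) / lambda) * phi x)%:E).
Proof.
(* With [n = p + 2] the exponent [n - 2] of the kernel becomes [p], and [3 <= n] becomes [0 < p]. *)
case: n hn x phi U U_open ball_U phi_C2 phi_eigen => [//|[//|p]] p0 x phi U oU BU C2 eig.
have main := newtonian_mean p0 lambda_gt0 r_gt0 oU BU C2 eig.
rewrite subSS subSS subn0; split=> // p1.
have {}p1 : p = 1%N by case: p1.
move: x phi U oU BU C2 eig main; rewrite {}p1 => x phi U _ _ _ _ main.
(* The first power of [enorm] computes to [enorm] itself, so [main] applies to the unexponentiated
   kernel. *)
rewrite [LHS]main Q3; last by rewrite mulr_ge0 ?sqrtr_ge0// ltW.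
by congr EFin; ring.
Qed.
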